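(* The sharp $\mathcal{S}^*_{\mathfrak{B}}$-radius for the class $\mathcal{S}^*[A,B]$ is given by: (i) $R_{\mathcal{S}^*_{\mathfrak{B}}}(\mathcal{S}^*[A,B])=\min\left\{1,\ \frac{\sqrt{2}\,e-\sqrt{1+e^2}}{A\sqrt{1+e^2}-\sqrt{2}\,eB}\right\}=:R_1$ whenever $-1\le B<0<A\le1$. (ii) Whenever $0\le B<A\le1$, with $R_1$ denoting the same expression, $$R_{\mathcal{S}^*_{\mathfrak{B}}}(\mathcal{S}^*[A,B])=\begin{cases}R_1 & \text{if } R_1\le R_0,\\ R_2 & \text{if } R_1>R_0,\end{cases}$$ where $$R_0:=\sqrt{\frac{\sqrt{2(1+e^2)}-e-1}{B\left(\sqrt{2(1+e^2)}\,A-Be-B\right)}}\quad(R_0:=+\infty\text{ if }B=0),\qquad R_2:=\min\left\{1,\ \frac{\sqrt{1+e^2}-\sqrt{2}}{A\sqrt{1+e^2}-\sqrt{2}\,B}\right\}.$$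
   Context: $\mathbb{D}$ is the open unit disk. $\mathcal{A}$ is the class of analytic functions $f$ in $\mathbb{D}$ with $f(z)=z+\sum_{n\ge2}a_nz^n$, and $\mathcal{S}\subset\mathcal{A}$ is the subclass of univalent functions. $f\prec g$ (subordination) means $f=g\circ w$ for some analytic $w:\mathbb{D}\to\mathbb{D}$ with $w(0)=0$. $\mathfrak{B}(z)=\sqrt{1+\tanh z}$ (principal branch), and $\mathcal{S}^*_{\mathfrak{B}}=\{f\in\mathcal{S}: zf'(z)/f(z)\prec\mathfrak{B}(z)\}$. $\mathcal{S}^*[A,B]=\{f\in\mathcal{S}: zf'(z)/f(z)\prec(1+Az)/(1+Bz)\}$. For a class $\mathcal{G}\subset\mathcal{A}$, the (sharp) $\mathcal{S}^*_{\mathfrak{B}}$-radius $R_{\mathcal{S}^*_{\mathfrak{B}}}(\mathcal{G})$ is the largest $R\in(0,1]$ such that for every $f\in\mathcal{G}$ and every $0<r\le R$ the function $z\mapsto f(rz)/r$ belongs to $\mathcal{S}^*_{\mathfrak{B}}$.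
   Formalization: R_1 is read as 1 when its denominator A√(1+e²)−√2·eB is zero or negative (possible only for B>0, e.g. A=1, B=0.9), where the printed quotient is undefined or negative and cannot be a radius in (0,1]; otherwise R_1 is as printed. *)

(* Defs.v *)
From Stdlib Require Import Reals.
From Coquelicot Require Import Coquelicot.
Open Scope R_scope.

Definition unit_disk (z : C) : Prop := Cmod z < 1.

Definition analytic_on_disk (f : C -> C) : Prop :=
  forall z : C, unit_disk z ->
    ex_derive (K := C_AbsRing) (V := C_NormedModule) f z.

Definition class_A (f : C -> C) : Prop :=
  analytic_on_disk f /\
  exists a : nat -> C,
    a 0%nat = RtoC 0 /\ a 1%nat = RtoC 1 /\
    forall z : C, unit_disk z ->
      is_pseries (K := C_AbsRing) (V := C_NormedModule) a z (f z).

Definition univalent_on_disk (f : C -> C) : Prop :=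
  forall z1 z2 : C, unit_disk z1 -> unit_disk z2 -> f z1 = f z2 -> z1 = z2.

Definition class_S (f : C -> C) : Prop := class_A f /\ univalent_on_disk f.

Definition subordinate (f g : C -> C) : Prop :=
  exists w : C -> C,
    analytic_on_disk w /\
    (forall z : C, unit_disk z -> unit_disk (w z)) /\
    w (RtoC 0) = RtoC 0 /\
    (forall z : C, unit_disk z -> f z = g (w z)).

(* z f'(z) / f(z), with its removable singularity at 0 filled in by the limit 1
   (for f in class_A); the total division would give 0 there. *)
Definition zf'_over_f (f : C -> C) (z : C) : C :=
  if Ceq_dec z (RtoC 0) then RtoC 1 else (z * C_derive f z / f z)%C.

Definition Cexp (z : C) : C :=
  (exp (Re z) * cos (Im z), exp (Re z) * sin (Im z)).

Definition Ctanh (z : C) : C :=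
  ((Cexp z - Cexp (- z)) / (Cexp z + Cexp (- z)))%C.

(* Principal square root, i.e. argument in (-PI/2, PI/2]; it maps the negative
   real axis to the positive imaginary axis. *)
Definition Csqrt (z : C) : C :=
  (sqrt ((Cmod z + Re z) / 2),
   if Rle_dec 0 (Im z) then sqrt ((Cmod z - Re z) / 2)
   else - sqrt ((Cmod z - Re z) / 2)).

Definition frakB (z : C) : C := Csqrt (1 + Ctanh z)%C.

Definition starlike_frakB (f : C -> C) : Prop :=
  class_S f /\ subordinate (zf'_over_f f) frakB.

Definition janowski (A B : R) (f : C -> C) : Prop :=
  class_S f /\
  subordinate (zf'_over_f f) (fun z => (1 + RtoC A * z) / (1 + RtoC B * z))%C.

Definition rescaled_in (H G : (C -> C) -> Prop) (rho : R) : Prop :=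
  forall f : C -> C, G f ->
  forall r : R, 0 < r <= rho -> H (fun z => f (RtoC r * z) / RtoC r)%C.

(* rho is the (sharp) H-radius of the class G. *)
Definition is_radius (H G : (C -> C) -> Prop) (rho : R) : Prop :=
  0 < rho <= 1 /\ rescaled_in H G rho /\
  (forall rho' : R, 0 < rho' <= 1 -> rescaled_in H G rho' -> rho' <= rho).

Definition euler_e : R := exp 1.

(* The quotient is the bound on r coming from
   (1 + A r) / (1 + B r) <= frakB 1 = sqrt 2 e / sqrt (1 + e^2).
   When its denominator is <= 0 (possible only for B > 0) that inequality holds
   for all r in (0, 1], so the quotient is read as +oo and rad_R1 is 1. *)
Definition rad_R1 (A B : R) : R :=
  let num := sqrt 2 * euler_e - sqrt (1 + euler_e ^ 2) in
  let den := A * sqrt (1 + euler_e ^ 2) - sqrt 2 * euler_e * B in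
  if Rlt_dec 0 den then Rmin 1 (num / den) else 1.

Definition rad_R0 (A B : R) : Rbar :=
  if Req_EM_T B 0 then p_infty
  else Finite (sqrt ((sqrt (2 * (1 + euler_e ^ 2)) - euler_e - 1) /
                     (B * (sqrt (2 * (1 + euler_e ^ 2)) * A - B * euler_e - B)))).

Definition rad_R2 (A B : R) : R :=
  Rmin 1 ((sqrt (1 + euler_e ^ 2) - sqrt 2) / (A * sqrt (1 + euler_e ^ 2) - sqrt 2 * B)).

(* Main.v *)
(* Write [b0 = frakB (-1) < b1 = frakB 1]. The heart of the matter is that the whole
   disk with diameter [(b0, b1)] lies in the image of [frakB]; the paper's two cases then
   only compare the real diameter of the image of [|w| < r] under
   [(1 + A w) / (1 + B w)] with [(b0, b1)].

   If [p = frakB w] then [w = 1/2 log (p / (sqrt 2 - p)) + 1/2 log (p / (sqrt 2 + p))].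
   Both arguments are Moebius images of [p], hence lie in disks with positive real
   diameter, and the logarithm maps the disk with diameter [(al, be)] into the one with
   diameter [(ln al, ln be)]. Adding the two disks gives [|w| < 1].

   That [z f' / f] takes [|z| < r] into the image of [|w| < r] is Schwarz's lemma. The
   radius is sharp for the solution of [z f' / f = (1 + A z) / (1 + B z)], whose values at
   real points near [r] and [-r] leave the interval [(b0, b1)]. *)

Require Import Defs.
From Stdlib Require Import Reals Lra Lia Psatz ClassicalEpsilon Classical.
From Coquelicot Require Import Coquelicot.
Open Scope R_scope.

(** Differentiability of the subordinating function [w] does not by itself exhibit an expansion of
    order two, on which the maximum principle below rests. The way out is that [w] can be solved
    for: with [f = z F] it is a rational expression in [z], [F] and [F'], and [F] is the sum of a
    power series, so the expansions come from manipulating coefficients. The bound [|w| < 1] for the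
    inverse of [frakB] comes out with the exact constant 1 because [b0^2 + b1^2 = 2] and
    [b1 / b0 = e]. On the real side everything reduces to two inequalities linear in [r], one for
    each end of the interval [(b0, b1)]. They are sufficient by the disk argument and necessary by
    the extremal function, so the radius is the largest [r] in [(0, 1]] that satisfies both. [R1]
    and [R2] are the largest solutions of each inequality alone, and [R0] tells which of the two
    binds, by comparing the centers of the two diameters. *)

Notation is_C_derive := (is_derive (K := C_AbsRing) (V := C_NormedModule)).
Notation ex_C_derive := (ex_derive (K := C_AbsRing) (V := C_NormedModule)).

Lemma C_ext (z w : C) : Re z = Re w -> Im z = Im w -> z = w.
Proof. destruct z, w; simpl; intros -> ->; reflexivity. Qed.

Lemma im_le_Cmod (z : C) : Rabs (Im z) <= Cmod z.
Proof. eapply Rle_trans; [apply Rmax_r | apply Rmax_Cmod]. Qed.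

Lemma Cmod_le_re_im (z : C) : Cmod z <= Rabs (Re z) + Rabs (Im z).
Proof.
  apply Rsqr_incr_0_var.
  - rewrite !Rsqr_pow2, Cmod2_alt.
    rewrite <- (pow2_abs (Re z)), <- (pow2_abs (Im z)).
    assert (H1 := Rabs_pos (Re z)). assert (H2 := Rabs_pos (Im z)). nra.
  - assert (H1 := Rabs_pos (Re z)). assert (H2 := Rabs_pos (Im z)). lra.
Qed.

Lemma C_sub_add (z w : C) : (w = z + (w - z))%C.
Proof. ring. Qed.

Lemma Cmod_sub_ge (z w : C) : Cmod z - Cmod w <= Cmod (z + w)%C.
Proof.
  assert (H := Cmod_triangle (z + w) (- w)).
  rewrite Cmod_opp in H. replace (z + w + - w)%C with z in H by ring. lra.
Qed.

(** * Complex derivatives and second order expansions *)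

Lemma is_derive_C_eps (g : C -> C) (z l : C) :
  is_C_derive g z l <->
  forall eps, 0 < eps -> exists d, 0 < d /\ forall t : C, Cmod t < d ->
    Cmod (g (z + t) - g z - l * t)%C <= eps * Cmod t.
Proof.
  split.
  - intros [_ H] eps Heps.
    specialize (H z (fun P HP => HP) (mkposreal eps Heps)).
    destruct H as [d Hd].
    exists (pos d). split; [apply cond_pos|].
    intros t Ht. specialize (Hd (z + t)%C).
    replace (Cmod t) with (Cmod (z + t - z)%C) by (f_equal; ring).
    replace (g (z + t) - g z - l * t)%C
      with ((g (z + t) - g z) - (z + t - z) * l)%C by ring.
    apply Hd.
    change (Cmod (z + t - z)%C < d). replace (z + t - z)%C with t by ring. exact Ht.
  - intros H. split; [apply is_linear_scal_l|].
    intros x Hx.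
    apply (is_filter_lim_locally_unique (V := AbsRing_NormedModule C_AbsRing)) in Hx. subst x. intros eps.
    destruct (H eps (cond_pos eps)) as [d [Hd0 Hd]].
    assert (Hy : forall y : C, Cmod (y - z)%C < d ->
      Cmod (g y - g z - (y - z) * l)%C <= eps * Cmod (y - z)%C).
    { intros y Hy. specialize (Hd (y - z)%C Hy).
      replace (z + (y - z))%C with y in Hd by ring.
      replace (g y - g z - (y - z) * l)%C with (g y - g z - l * (y - z))%C by ring. exact Hd. }
    exists (mkposreal d Hd0). intros y Hy'. exact (Hy y Hy').
Qed.

Definition bounded_near0 (k : C -> C) : Prop :=
  exists M d, 0 < d /\ forall t : C, Cmod t < d -> Cmod (k t) <= M.

Lemma bounded_near0_const (c : C) : bounded_near0 (fun _ => c).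
Proof. exists (Cmod c), 1. split; [lra|]. intros; lra. Qed.

Lemma bounded_near0_id : bounded_near0 (fun t => t).
Proof. exists 1, 1. split; [lra|]. intros; lra. Qed.

Lemma bounded_near0_plus (k1 k2 : C -> C) :
  bounded_near0 k1 -> bounded_near0 k2 -> bounded_near0 (fun t => k1 t + k2 t)%C.
Proof.
  intros [M1 [d1 [P1 H1]]] [M2 [d2 [P2 H2]]].
  exists (M1 + M2), (Rmin d1 d2). split; [apply Rmin_pos; assumption|].
  intros t Ht.
  specialize (H1 t (Rlt_le_trans _ _ _ Ht (Rmin_l _ _))).
  specialize (H2 t (Rlt_le_trans _ _ _ Ht (Rmin_r _ _))).
  eapply Rle_trans; [apply Cmod_triangle|lra].
Qed.

Lemma bounded_near0_mult (k1 k2 : C -> C) :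
  bounded_near0 k1 -> bounded_near0 k2 -> bounded_near0 (fun t => k1 t * k2 t)%C.
Proof.
  intros [M1 [d1 [P1 H1]]] [M2 [d2 [P2 H2]]].
  exists (M1 * M2), (Rmin d1 d2). split; [apply Rmin_pos; assumption|].
  intros t Ht.
  specialize (H1 t (Rlt_le_trans _ _ _ Ht (Rmin_l _ _))).
  specialize (H2 t (Rlt_le_trans _ _ _ Ht (Rmin_r _ _))).
  rewrite Cmod_mult. apply Rmult_le_compat; auto using Cmod_ge_0.
Qed.

(** The factor of the cubic remainder is only asked to be bounded. So sums, products and inverses
    stay in the class by plain algebra, and an expansion yields the value, the derivative, a local
    Lipschitz bound and the four-point average of the maximum principle. *)
Definition expands2 (g : C -> C) (z a b c : C) : Prop :=
  exists k, bounded_near0 k /\ exists d, 0 < d /\ forall t : C, Cmod t < d ->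
    g (z + t)%C = (a + b * t + c * t ^ 2 + t ^ 3 * k t)%C.

Lemma expands2_value g z a b c : expands2 g z a b c -> g z = a.
Proof.
  intros [k [_ [d [Hd H]]]]. specialize (H (RtoC 0)).
  rewrite Cmod_0 in H. specialize (H Hd).
  replace (z + 0)%C with z in H by ring. rewrite H. ring.
Qed.

Lemma expands2_derive g z a b c : expands2 g z a b c ->
  is_C_derive g z b.
Proof.
  intros H. assert (Hv := expands2_value _ _ _ _ _ H).
  destruct H as [k [Hk [d [Hd H]]]].
  assert (HB : bounded_near0 (fun t => c + t * k t)%C).
  { apply bounded_near0_plus; [apply bounded_near0_const|].
    apply bounded_near0_mult; [apply bounded_near0_id|exact Hk]. }
  destruct HB as [M [d' [Hd' HM]]].
  apply is_derive_C_eps. intros eps Heps.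
  assert (HM1 : 0 < Rabs M + 1) by (assert (H1 := Rabs_pos M); lra).
  exists (Rmin (Rmin d d') (eps / (Rabs M + 1))). split.
  { repeat apply Rmin_pos; auto. apply Rdiv_lt_0_compat; auto. }
  intros t Ht.
  assert (Ht1 : Cmod t < d).
  { eapply Rlt_le_trans; [exact Ht|]. eapply Rle_trans; [apply Rmin_l|apply Rmin_l]. }
  assert (Ht2 : Cmod t < d').
  { eapply Rlt_le_trans; [exact Ht|]. eapply Rle_trans; [apply Rmin_l|apply Rmin_r]. }
  assert (Ht3 : Cmod t < eps / (Rabs M + 1)).
  { eapply Rlt_le_trans; [exact Ht|apply Rmin_r]. }
  rewrite H by exact Ht1. rewrite Hv.
  replace (a + b * t + c * t ^ 2 + t ^ 3 * k t - a - b * t)%C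
    with ((c + t * k t) * t * t)%C by ring.
  rewrite !Cmod_mult. specialize (HM t Ht2).
  apply Rmult_le_compat_r; [apply Cmod_ge_0|].
  apply Rle_trans with ((Rabs M + 1) * (eps / (Rabs M + 1))).
  - apply Rmult_le_compat; try apply Cmod_ge_0; try lra.
    assert (H1 := Rle_abs M). lra.
  - apply Req_le. field. lra.
Qed.

Lemma expands2_id z : expands2 (fun t => t) z z 1 0.
Proof.
  exists (fun _ => RtoC 0). split; [apply bounded_near0_const|].
  exists 1. split; [lra|]. intros; ring.
Qed.

Lemma expands2_plus g h z a b c a' b' c' :
  expands2 g z a b c -> expands2 h z a' b' c' ->
  expands2 (fun t => g t + h t)%C z (a + a') (b + b') (c + c').
Proof.
  intros [k [Hk [d [Hd H]]]] [k' [Hk' [d' [Hd' H']]]].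
  exists (fun t => k t + k' t)%C. split; [apply bounded_near0_plus; assumption|].
  exists (Rmin d d'). split; [apply Rmin_pos; assumption|].
  intros t Ht. rewrite H, H'. ring.
  - eapply Rlt_le_trans; eauto using Rmin_r.
  - eapply Rlt_le_trans; eauto using Rmin_l.
Qed.

Lemma bounded_near0_opp (k : C -> C) : bounded_near0 k -> bounded_near0 (fun t => - k t)%C.
Proof.
  intros [M [d [P H]]]. exists M, d. split; [assumption|]. intros t Ht. rewrite Cmod_opp; auto.
Qed.

Ltac solve_bounded_near0 :=
  repeat first [ assumption | apply bounded_near0_const | apply bounded_near0_id
               | apply bounded_near0_plus | apply bounded_near0_opp | apply bounded_near0_mult ].

Lemma expands2_mult g h z a b c a' b' c' :
  expands2 g z a b c -> expands2 h z a' b' c' ->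
  expands2 (fun t => g t * h t)%C z (a * a') (a * b' + b * a') (a * c' + b * b' + c * a').
Proof.
  intros [k [Hk [d [Hd H]]]] [k' [Hk' [d' [Hd' H']]]].
  (* The terms of degree at least 3 of the product, divided by [t ^ 3]; the nested powers of [t] let
     boundedness be read off the shape of the expression. *)
  exists (fun t => a * k' t + k t * a' + (b * c' + c * b') +
       t * (b * k' t + k t * b' + c * c') + t * (t * (c * k' t + k t * c')) +
       t * (t * (t * (k t * k' t))))%C.
  split; [solve_bounded_near0|].
  exists (Rmin d d'). split; [apply Rmin_pos; assumption|].
  intros t Ht. rewrite H, H'. ring.
  - eapply Rlt_le_trans; eauto using Rmin_r.
  - eapply Rlt_le_trans; eauto using Rmin_l.
Qed.

Lemma expands2_scal u g z a b c :
  expands2 g z a b c -> expands2 (fun t => u * g t)%C z (u * a) (u * b) (u * c).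
Proof.
  intros [k [Hk [d [Hd H]]]].
  exists (fun t => u * k t)%C. split; [solve_bounded_near0|].
  exists d. split; [assumption|]. intros t Ht. rewrite H by assumption. ring.
Qed.

Lemma expands2_inv g z a b c : a <> RtoC 0 -> expands2 g z a b c ->
  exists a' b' c', expands2 (fun t => / g t)%C z a' b' c'.
Proof.
  intros Ha [k [Hk [d [Hd H]]]].
  set (m := fun t : C => (b + t * c + t * (t * k t))%C).
  assert (Hm : bounded_near0 m) by (unfold m; solve_bounded_near0).
  destruct Hm as [M [d' [Hd' HM]]].
  assert (Ha0 : 0 < Cmod a) by (apply Cmod_gt_0; exact Ha).
  assert (HM1 : 0 < Rabs M + 1) by (assert (H1 := Rabs_pos M); lra).
  set (d0 := Rmin (Rmin d d') (Cmod a / 2 / (Rabs M + 1))).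
  assert (Hd0 : 0 < d0).
  { unfold d0. repeat apply Rmin_pos; auto. apply Rdiv_lt_0_compat; lra. }
  assert (Hlow : forall t, Cmod t < d0 -> g (z + t)%C = (a + t * m t)%C /\ Cmod a / 2 <= Cmod (g (z + t)%C)).
  { intros t Ht.
    assert (Ht1 : Cmod t < d).
    { eapply Rlt_le_trans; [exact Ht|]. eapply Rle_trans; [apply Rmin_l|apply Rmin_l]. }
    assert (Ht2 : Cmod t < d').
    { eapply Rlt_le_trans; [exact Ht|]. eapply Rle_trans; [apply Rmin_l|apply Rmin_r]. }
    assert (Ht3 : Cmod t < Cmod a / 2 / (Rabs M + 1)).
    { eapply Rlt_le_trans; [exact Ht|apply Rmin_r]. }
    assert (E : g (z + t)%C = (a + t * m t)%C).
    { rewrite H by exact Ht1. unfold m. ring. }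
    split; [exact E|]. rewrite E.
    eapply Rle_trans; [|apply Cmod_sub_ge]. rewrite Cmod_mult.
    assert (Cmod t * Cmod (m t) <= Cmod a / 2); [|lra].
    apply Rle_trans with (Cmod a / 2 / (Rabs M + 1) * (Rabs M + 1)).
    - apply Rmult_le_compat; try apply Cmod_ge_0; try lra.
      specialize (HM t Ht2). assert (H1 := Rle_abs M). lra.
    - apply Req_le. field. lra. }
  assert (Hinv : bounded_near0 (fun t => / g (z + t))%C).
  { exists (/ (Cmod a / 2)), d0. split; [exact Hd0|].
    intros t Ht. destruct (Hlow t Ht) as [_ HL].
    rewrite Cmod_inv.
    - apply Rinv_le_contravar; lra.
    - apply Cmod_gt_0. lra. }
  (* With [g = a (1 + p t + q t^2 + ...)] the reciprocal is [1/a (1 - p t + r t^2 + ...)] for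
     [r = p^2 - q]. The remainder is [1 / g] times the part of degree at least 3 in
     [1 - (1 - p t + r t^2) g / a]. *)
  set (p := (b / a)%C). set (q := (c / a)%C).
  exists (/ a)%C, (- p / a)%C, ((p * p - q) / a)%C.
  set (r := (p * p - q)%C).
  exists (fun t => - / g (z + t) * (p * r + - (q * p) + / a * k t + t * (q * r + - (/ a * k t * p)) + t * (t * (/ a * k t * r))))%C.
  split; [solve_bounded_near0|].
  exists d0. split; [exact Hd0|].
  intros t Ht. destruct (Hlow t Ht) as [E HL].
  assert (Hn : g (z + t)%C <> RtoC 0) by (apply Cmod_gt_0; lra).
  assert (Ht1 : Cmod t < d).
  { eapply Rlt_le_trans; [exact Ht|]. eapply Rle_trans; [apply Rmin_l|apply Rmin_l]. }
  specialize (H t Ht1). rewrite H in *. unfold r, p, q.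
  field. split; assumption.
Qed.

(** * Complex power series *)

(** The split into real and imaginary parts gives access to the real convergence tests and, through
    [Series], to a sum that is a function of the sequence. *)
Definition csum (s : nat -> C) (l : C) : Prop :=
  is_series (V := R_NormedModule) (fun n => Re (s n)) (Re l) /\
  is_series (V := R_NormedModule) (fun n => Im (s n)) (Im l).

Lemma csum_is_series (s : nat -> C) (l : C) :
  csum s l <-> is_series (K := C_AbsRing) (V := C_NormedModule) s l.
Proof.
  assert (HR : forall n, Re (sum_n (G := C_NormedModule) s n) = sum_n (G := R_NormedModule) (fun n => Re (s n)) n).
  { induction n; [rewrite !sum_O|rewrite !sum_Sn, <- IHn]; reflexivity. }
  assert (HI : forall n, Im (sum_n (G := C_NormedModule) s n) = sum_n (G := R_NormedModule) (fun n => Im (s n)) n).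
  { induction n; [rewrite !sum_O|rewrite !sum_Sn, <- IHn]; reflexivity. }
  unfold csum, is_series. split.
  - intros [H1 H2]. apply filterlim_locally. intros eps.
    assert (H := filter_and _ _ (proj1 (filterlim_locally _ _) H1 eps)
      (proj1 (filterlim_locally _ _) H2 eps)). revert H. apply filter_imp.
    intros n [A B]. rewrite <- HR in A. rewrite <- HI in B. split; assumption.
  - intros H. split; apply filterlim_locally; intros eps;
    assert (H' := proj1 (filterlim_locally _ _) H eps); revert H'; apply filter_imp;
    intros n [A B]; [rewrite <- HR|rewrite <- HI]; assumption.
Qed.

Lemma csum_ext s s' l : (forall n, s n = s' n) -> csum s l -> csum s' l.
Proof.
  intros E [H1 H2]. split.
  - revert H1. apply is_series_ext. intros n. rewrite E. reflexivity.
  - revert H2. apply is_series_ext. intros n. rewrite E. reflexivity.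
Qed.

Lemma csum_plus s s' l l' : csum s l -> csum s' l' -> csum (fun n => s n + s' n)%C (l + l')%C.
Proof.
  intros [H1 H2] [H3 H4]. split.
  - exact (is_series_plus _ _ _ _ H1 H3).
  - exact (is_series_plus _ _ _ _ H2 H4).
Qed.

Lemma csum_scal u s l : csum s l -> csum (fun n => u * s n)%C (u * l)%C.
Proof.
  rewrite !csum_is_series. exact (is_series_scal (K := C_AbsRing) (V := C_NormedModule) u s l).
Qed.

Lemma csum_decr_1 s l : csum (fun n => s (S n)) l -> csum s (l + s 0%nat)%C.
Proof.
  intros [H1 H2]. split; apply is_series_decr_1.
  - match goal with |- is_series _ ?x => replace x with (Re l) end; [exact H1|].
    change (Re l = Re l + Re (s 0%nat) + - Re (s 0%nat)). ring.
  - match goal with |- is_series _ ?x => replace x with (Im l) end; [exact H2|].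
    change (Im l = Im l + Im (s 0%nat) + - Im (s 0%nat)). ring.
Qed.

Definition cseries (s : nat -> C) : C :=
  (Series (fun n => Re (s n)), Series (fun n => Im (s n))).

Lemma csum_cseries s l : csum s l -> cseries s = l.
Proof. intros [H1 H2]. apply C_ext; apply is_series_unique; assumption. Qed.

Lemma csum_dominated (s : nat -> C) M q : 0 <= q < 1 ->
  (forall n, Cmod (s n) <= M * q ^ n) ->
  csum s (cseries s) /\ Cmod (cseries s) <= 2 * (M / (1 - q)).
Proof.
  intros Hq Hs.
  assert (HG : is_series (fun n => M * q ^ n) (M / (1 - q))).
  { apply (is_series_scal (V := R_NormedModule) M).
    apply is_series_geom. rewrite Rabs_pos_eq; lra. }
  assert (HG' : ex_series (fun n => M * q ^ n)) by (eexists; exact HG).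
  assert (KR : forall u : nat -> R, (forall n, Rabs (u n) <= M * q ^ n) ->
     is_series u (Series u) /\ Rabs (Series u) <= M / (1 - q)).
  { intros u Hu.
    assert (HA : ex_series (fun n => Rabs (u n))).
    { apply (ex_series_le (V := R_CompleteNormedModule) _ (fun n => M * q ^ n)); [|exact HG'].
      intros n. unfold norm; simpl. unfold abs; simpl. rewrite Rabs_Rabsolu. apply Hu. }
    split.
    - apply Series_correct. apply ex_series_Rabs. exact HA.
    - eapply Rle_trans; [apply Series_Rabs; exact HA|].
      rewrite <- (is_series_unique _ _ HG). apply Series_le; [|exact HG'].
      intros n. split; [apply Rabs_pos|apply Hu]. }
  destruct (KR (fun n => Re (s n))) as [A1 A2].
  { intros n. eapply Rle_trans; [apply re_le_Cmod|apply Hs]. }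
  destruct (KR (fun n => Im (s n))) as [B1 B2].
  { intros n. eapply Rle_trans; [apply im_le_Cmod|apply Hs]. }
  split; [split; assumption|].
  eapply Rle_trans; [apply Cmod_le_re_im|]. unfold cseries; simpl. lra.
Qed.

(** Radius of convergence at least 1, stated as boundedness of the terms: this is what a convergent
    series gives back and what geometric domination consumes. *)
Definition disk_coeffs (a : nat -> C) : Prop :=
  forall rho, 0 < rho < 1 -> exists M, forall n, Cmod (a n) * rho ^ n <= M.

Definition psum (a : nat -> C) (z : C) : C := cseries (fun n => a n * z ^ n)%C.

Lemma disk_coeffs_bound (a : nat -> C) rho : disk_coeffs a -> 0 < rho < 1 ->
  exists M, 0 <= M /\ forall n, Cmod (a n) <= M / rho ^ n.
Proof.
  intros Ha Hr. destruct (Ha rho Hr) as [M HM]. exists M. split.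
  - eapply Rle_trans; [|apply (HM 0%nat)]. rewrite pow_O, Rmult_1_r. apply Cmod_ge_0.
  - intros n. assert (Hp : 0 < rho ^ n) by (apply pow_lt; lra).
    apply Rmult_le_reg_r with (rho ^ n); [exact Hp|].
    eapply Rle_trans; [apply HM|]. apply Req_le. field. lra.
Qed.

(** An arbitrary [x] of growth [sigma ^ n] stands in place of the powers of [z], so that the Taylor
    coefficients and remainders of these powers are covered too. *)
Lemma disk_coeffs_dominated (a x : nat -> C) sigma tau M L : 0 <= sigma < tau -> 0 <= M ->
  (forall n, Cmod (a n) <= M / tau ^ n) -> (forall n, Cmod (x n) <= L * sigma ^ n) ->
  csum (fun n => a n * x n)%C (cseries (fun n => a n * x n)%C) /\
  Cmod (cseries (fun n => a n * x n)%C) <= 2 * (M * L / (1 - sigma / tau)).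
Proof.
  intros Hs HM Ha Hx. apply csum_dominated.
  - split; [apply Rdiv_le_0_compat; lra|].
    apply Rmult_lt_reg_r with tau; [lra|]. unfold Rdiv. rewrite Rmult_assoc, Rinv_l; lra.
  - intros n. rewrite Cmod_mult.
    eapply Rle_trans; [apply Rmult_le_compat; [apply Cmod_ge_0|apply Cmod_ge_0|apply Ha|apply Hx]|].
    apply Req_le. unfold Rdiv. rewrite Rpow_mult_distr, pow_inv. ring.
Qed.

Lemma psum_csum a z : disk_coeffs a -> Cmod z < 1 -> csum (fun n => a n * z ^ n)%C (psum a z).
Proof.
  intros Ha Hz. assert (H0 := Cmod_ge_0 z).
  destruct (disk_coeffs_bound a ((1 + Cmod z) / 2) Ha) as [M [HM HB]]; [lra|].
  refine (proj1 (disk_coeffs_dominated a (fun n => z ^ n)%C (Cmod z) _ M 1 _ HM HB _)); [lra|].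
  intros n. rewrite Cmod_pow. lra.
Qed.

Lemma disk_coeffs_of_csum (a : nat -> C) (f : C -> C) :
  (forall z, Cmod z < 1 -> csum (fun n => a n * z ^ n)%C (f z)) -> disk_coeffs a.
Proof.
  intros H rho Hr.
  assert (Hm : Cmod (RtoC rho) = rho) by (rewrite Cmod_R, Rabs_pos_eq; lra).
  destruct (H (RtoC rho)) as [H1 H2]; [lra|].
  assert (L1 := ex_series_lim_0 _ (ex_intro _ _ H1)).
  assert (L2 := ex_series_lim_0 _ (ex_intro _ _ H2)).
  assert (BND : forall u : nat -> R, is_lim_seq u 0 -> exists M, forall n, Rabs (u n) <= M).
  { intros u Hu. destruct (filterlim_bounded (K := R_AbsRing) (V := R_NormedModule) u) as [M HM].
    - exists 0. exact Hu.
    - exists M. exact HM. }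
  destruct (BND _ L1) as [M1 B1]. destruct (BND _ L2) as [M2 B2].
  exists (M1 + M2). intros n.
  replace (Cmod (a n) * rho ^ n) with (Cmod (a n * RtoC rho ^ n)%C)
    by (rewrite Cmod_mult, Cmod_pow, Hm; reflexivity).
  eapply Rle_trans; [apply Cmod_le_re_im|].
  specialize (B1 n). specialize (B2 n). lra.
Qed.

(** The bound solves the recurrence exactly when [u] is replaced by [rho] and [y n] by
    [L * sigma ^ n], so the induction closes with a constant independent of [n]. *)
Lemma geometric_recurrence_bound (x y : nat -> C) (u : C) L rho sigma :
  rho < sigma -> 0 <= sigma -> 0 <= L -> Cmod u <= rho -> x 0%nat = RtoC 0 ->
  (forall n, x (S n) = y n + u * x n)%C -> (forall n, Cmod (y n) <= L * sigma ^ n) ->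
  forall n, Cmod (x n) <= L / (sigma - rho) * sigma ^ n.
Proof.
  intros Hrs Hs HL Hu H0 HS Hy.
  assert (HK : 0 <= L / (sigma - rho)) by (apply Rdiv_le_0_compat; lra).
  induction n.
  - rewrite H0, Cmod_0. simpl. lra.
  - rewrite HS. eapply Rle_trans; [apply Cmod_triangle|]. rewrite Cmod_mult.
    assert (H1 : Cmod u * Cmod (x n) <= rho * (L / (sigma - rho) * sigma ^ n)).
    { apply Rmult_le_compat; auto using Cmod_ge_0. }
    specialize (Hy n).
    replace (L / (sigma - rho) * sigma ^ S n) with
      (L * sigma ^ n + rho * (L / (sigma - rho) * sigma ^ n)).
    + lra.
    + simpl. field. lra.
Qed.

(** These are [n z^(n-1)], [binom(n, 2) z^(n-2)] and the rest of [(z + t)^n] divided by [t^3]. The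
    recursions come from multiplying an expansion by [z + t]; they fit the geometric bound and avoid
    binomial sums. *)
Fixpoint pow_coef1 (z : C) (n : nat) : C :=
  match n with O => RtoC 0 | S n => z ^ n + z * pow_coef1 z n end%C.
Fixpoint pow_coef2 (z : C) (n : nat) : C :=
  match n with O => RtoC 0 | S n => pow_coef1 z n + z * pow_coef2 z n end%C.
Fixpoint pow_rem3 (z t : C) (n : nat) : C :=
  match n with O => RtoC 0 | S n => pow_coef2 z n + (z + t) * pow_rem3 z t n end%C.

Lemma pow_expand z t n :
  ((z + t) ^ n = z ^ n + t * pow_coef1 z n + t ^ 2 * pow_coef2 z n + t ^ 3 * pow_rem3 z t n)%C.
Proof.
  induction n.
  - simpl. ring.
  - rewrite Cpow_S, IHn. simpl. ring.
Qed.

Lemma pow_coef1_S z n : pow_coef1 z (S n) = (INR (S n) * z ^ n)%C.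
Proof.
  induction n.
  - simpl. ring.
  - change (pow_coef1 z (S (S n))) with (z ^ S n + z * pow_coef1 z (S n))%C. rewrite IHn.
    rewrite (S_INR (S n)), RtoC_plus. simpl. ring.
Qed.

Definition dcoeffs (a : nat -> C) (n : nat) : C := (INR (S n) * a (S n))%C.

(** Differentiation costs a little radius: [n rho^(n-1)] is at most a multiple of [tau^n] for
    [rho < tau < 1], and [tau] is still admissible for [a]. *)
Lemma disk_coeffs_derive a : disk_coeffs a -> disk_coeffs (dcoeffs a).
Proof.
  intros Ha rho Hr.
  set (tau := (1 + rho) / 2).
  destruct (disk_coeffs_bound a tau Ha) as [M [HM HB]]; [unfold tau; lra|].
  assert (Ht : rho < tau < 1) by (unfold tau; lra).
  exists (M * (1 / (tau - rho))). intros n.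
  assert (HP := geometric_recurrence_bound (pow_coef1 (RtoC rho)) (fun n => RtoC rho ^ n)%C (RtoC rho) 1 rho tau).
  assert (Hm : Cmod (RtoC rho) = rho) by (rewrite Cmod_R, Rabs_pos_eq; lra).
  assert (Htn : 0 < tau ^ S n) by (apply pow_lt; lra).
  replace (Cmod (dcoeffs a n) * rho ^ n) with (Cmod (a (S n)) * Cmod (pow_coef1 (RtoC rho) (S n))).
  - apply Rle_trans with (M / tau ^ S n * (1 / (tau - rho) * tau ^ S n)).
    + apply Rmult_le_compat; try apply Cmod_ge_0; [apply HB|].
      apply HP; try lra; try reflexivity.
      intros k. rewrite Cmod_pow, Hm. rewrite Rmult_1_l. apply pow_incr. lra.
    + apply Req_le. field. lra.
  - rewrite pow_coef1_S. unfold dcoeffs. rewrite !Cmod_mult, Cmod_pow, Hm. ring.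
Qed.

Lemma psum_expands a z : disk_coeffs a -> Cmod z < 1 ->
  exists c, expands2 (psum a) z (psum a z) (psum (dcoeffs a) z) c.
Proof.
  intros Ha Hz. assert (H0 := Cmod_ge_0 z).
  set (t := 1 - Cmod z). assert (Ht : 0 < t) by (unfold t; lra).
  (* Nested radii [|z| < rho < sigma < tau < 1]: [rho] also dominates [|z + w|] for the increments
     [w] in use, [sigma] governs the growth of the coefficients of [(z + w) ^ n], and [tau] bounds
     those of [a]. *)
  set (rho := Cmod z + t / 4). set (sigma := Cmod z + t / 2). set (tau := Cmod z + 3 * t / 4).
  assert (Hrs : rho < sigma) by (unfold rho, sigma; lra).
  assert (Hst : 0 <= sigma < tau) by (unfold tau, sigma; lra).
  destruct (disk_coeffs_bound a tau Ha) as [M [HM HB]]; [unfold tau, t; lra|].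
  set (K := 1 / (sigma - rho)).
  assert (HK : 0 <= K) by (apply Rdiv_le_0_compat; lra).
  assert (B0 : forall n, Cmod (z ^ n)%C <= 1 * sigma ^ n).
  { intros n. rewrite Cmod_pow, Rmult_1_l. apply pow_incr. unfold sigma; lra. }
  assert (B1 : forall n, Cmod (pow_coef1 z n) <= K * sigma ^ n).
  { apply (geometric_recurrence_bound _ (fun n => z ^ n)%C z); auto; try reflexivity; try lra.
    unfold rho; lra. }
  assert (B2 : forall n, Cmod (pow_coef2 z n) <= K / (sigma - rho) * sigma ^ n).
  { apply (geometric_recurrence_bound _ (pow_coef1 z) z); auto; try reflexivity; try lra.
    unfold rho; lra. }
  set (K2 := K / (sigma - rho)) in *.
  assert (HK2 : 0 <= K2) by (apply Rdiv_le_0_compat; lra).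
  assert (B3 : forall w, Cmod w < t / 4 -> forall n, Cmod (pow_rem3 z w n) <= K2 / (sigma - rho) * sigma ^ n).
  { intros w Hw. apply (geometric_recurrence_bound _ (pow_coef2 z) (z + w)%C); auto; try reflexivity; try lra.
    eapply Rle_trans; [apply Cmod_triangle|]. unfold rho; lra. }
  destruct (disk_coeffs_dominated a (pow_coef1 z) sigma tau M K Hst HM HB B1) as [S1 _].
  destruct (disk_coeffs_dominated a (pow_coef2 z) sigma tau M K2 Hst HM HB B2) as [S2 _].
  exists (cseries (fun n => a n * pow_coef2 z n)%C).
  exists (fun w => cseries (fun n => a n * pow_rem3 z w n)%C). split.
  { exists (2 * (M * (K2 / (sigma - rho)) / (1 - sigma / tau))), (t / 4). split; [lra|].
    intros w Hw.
    apply (disk_coeffs_dominated a (pow_rem3 z w) sigma tau M _ Hst HM HB (B3 w Hw)). }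
  exists (t / 4). split; [lra|]. intros w Hw.
  destruct (disk_coeffs_dominated a (pow_rem3 z w) sigma tau M _ Hst HM HB (B3 w Hw)) as [S3 _].
  assert (E1 : cseries (fun n => a n * pow_coef1 z n)%C = psum (dcoeffs a) z).
  { apply csum_cseries.
    replace (psum (dcoeffs a) z) with (psum (dcoeffs a) z + a 0%nat * pow_coef1 z 0)%C by (simpl; ring).
    apply (csum_decr_1 (fun n => a n * pow_coef1 z n)%C).
    apply csum_ext with (fun n => dcoeffs a n * z ^ n)%C.
    - intros n. rewrite pow_coef1_S. unfold dcoeffs. ring.
    - apply psum_csum; [apply disk_coeffs_derive; exact Ha|exact Hz]. }
  rewrite <- E1.
  apply csum_cseries.
  assert (S := csum_plus _ _ _ _ (csum_plus _ _ _ _ (csum_plus _ _ _ _ (psum_csum a z Ha Hz)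
     (csum_scal w _ _ S1)) (csum_scal (w ^ 2) _ _ S2)) (csum_scal (w ^ 3) _ _ S3)).
  match goal with |- csum _ ?x => match type of S with csum _ ?y => replace x with y by ring end end.
  revert S. apply csum_ext. intros n. rewrite pow_expand. ring.
Qed.

(** * Maximum principle *)

(** Compactness as a passage from local to uniform: [P z d] reads that the margin [d] is good enough
    at [z], and smaller margins are only better. It serves for boundedness and for the attainment of
    a maximum. *)
Lemma closed_disk_compact (P : C -> R -> Prop) (rho : R) :
  (forall z d d', P z d -> 0 < d' <= d -> P z d') ->
  (forall z, Cmod z <= rho -> exists d, 0 < d /\
     forall w, Cmod w <= rho -> Cmod (w - z)%C < d -> P w d) ->
  exists d, 0 < d /\ forall z, Cmod z <= rho -> P z d.
Proof.
  intros Hanti Hloc.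
  (* The radius is halved because the covering controls each coordinate, and a modulus is at most
     the sum of two of them. Off the disk, half the excess of the modulus over [rho] leaves no point
     of the disk to check. *)
  assert (Hex : forall x y : R, exists d : posreal, forall w, Cmod w <= rho ->
     Cmod (w - (x, y))%C < 2 * d -> P w d).
  { intros x y. destruct (Rle_lt_dec (Cmod (x, y)) rho) as [Hin|Hout].
    - destruct (Hloc (x, y) Hin) as [d [Hd HP]].
      assert (Hd2 : 0 < d / 2) by lra.
      exists (mkposreal _ Hd2). simpl. intros w Hw Hwd.
      apply Hanti with d; [apply HP; [assumption|lra]|lra].
    - assert (Hd2 : 0 < (Cmod (x, y) - rho) / 2) by lra.
      exists (mkposreal _ Hd2). simpl. intros w Hw Hwd. exfalso.
      assert (H := Cmod_sub_ge (x, y) (w - (x, y))%C).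
      replace ((x, y) + (w - (x, y)))%C with w in H by ring. lra. }
  set (delta := fun x y => proj1_sig (constructive_indefinite_description _ (Hex x y))).
  destruct (compactness_value_2d (- rho) rho (- rho) rho delta) as [d Hd].
  exists d. split; [apply cond_pos|]. intros z Hz.
  apply NNPP. intros HN.
  assert (Hre := re_le_Cmod z). assert (Him := im_le_Cmod z).
  apply (Hd (Re z) (Im z)).
  - apply Rabs_le_between in Hre. lra.
  - apply Rabs_le_between in Him. lra.
  - intros [u [v [_ [_ [Hu [Hv Hduv]]]]]]. apply HN.
    apply Hanti with (delta u v); [|split; [apply cond_pos|exact Hduv]].
    unfold delta in *.
    destruct (constructive_indefinite_description _ (Hex u v)) as [e He]. simpl in *.
    apply He; [exact Hz|].
    eapply Rle_lt_trans; [apply Cmod_le_re_im|]. simpl.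
    change (Rabs (Re z - u) + Rabs (Im z - v) < 2 * e). lra.
Qed.

Definition lipschitz_at (u : C -> R) (z : C) : Prop :=
  exists L d, 0 <= L /\ 0 < d /\ forall w, Cmod (w - z)%C < d -> Rabs (u w - u z) <= L * Cmod (w - z)%C.

Lemma closed_disk_max (u : C -> R) (rho : R) : 0 <= rho ->
  (forall z, Cmod z <= rho -> lipschitz_at u z) ->
  exists z0, Cmod z0 <= rho /\ forall z, Cmod z <= rho -> u z <= u z0.
Proof.
  intros Hrho Hu.
  assert (Hc : forall z, Cmod z <= rho -> forall eps, 0 < eps -> exists d, 0 < d /\
     forall w, Cmod (w - z)%C < d -> u w < u z + eps).
  { intros z Hz eps Heps. destruct (Hu z Hz) as [L [d [HL [Hd H]]]].
    exists (Rmin d (eps / (L + 1))). split.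
    - apply Rmin_pos; [assumption|apply Rdiv_lt_0_compat; lra].
    - intros w Hw.
      assert (H1 : Cmod (w - z)%C < d) by (eapply Rlt_le_trans; [exact Hw|apply Rmin_l]).
      assert (H2 : Cmod (w - z)%C < eps / (L + 1)) by (eapply Rlt_le_trans; [exact Hw|apply Rmin_r]).
      specialize (H w H1). assert (H3 := Rle_abs (u w - u z)).
      assert (H4 : (L + 1) * Cmod (w - z)%C < eps).
      { apply Rlt_le_trans with ((L + 1) * (eps / (L + 1))).
        - apply Rmult_lt_compat_l; lra.
        - apply Req_le. field. lra. }
      assert (H5 := Cmod_ge_0 (w - z)%C). lra. }
  (* Boundedness above, written with [1 / d] so that the claim weakens as [d] shrinks. *)
  destruct (closed_disk_compact (fun z d => u z <= 1 / d) rho) as [d0 [Hd0 Hb]].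
  { intros z d d' H [Hd' Hdd']. eapply Rle_trans; [exact H|].
    unfold Rdiv. rewrite !Rmult_1_l. apply Rinv_le_contravar; lra. }
  { intros z Hz. destruct (Hc z Hz 1 Rlt_0_1) as [d [Hd H]].
    assert (HA := Rabs_pos (u z)).
    exists (Rmin d (1 / (Rabs (u z) + 1))). split.
    - apply Rmin_pos; [assumption|apply Rdiv_lt_0_compat; lra].
    - intros w _ Hw.
      assert (H1 : Cmod (w - z)%C < d) by (eapply Rlt_le_trans; [exact Hw|apply Rmin_l]).
      specialize (H w H1). assert (H2 := Rle_abs (u z)).
      apply Rle_trans with (Rabs (u z) + 1); [lra|].
      replace (Rabs (u z) + 1) with (/ (1 / (Rabs (u z) + 1))) at 1 by (field; lra).
      unfold Rdiv at 2. rewrite Rmult_1_l. apply Rinv_le_contravar; [|apply Rmin_r].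
      apply Rmin_pos; [assumption|apply Rdiv_lt_0_compat; lra]. }
  destruct (completeness (fun x => exists z, Cmod z <= rho /\ x = u z)) as [s [Hs1 Hs2]].
  { exists (1 / d0). intros x [z [Hz ->]]. apply Hb, Hz. }
  { exists (u 0%R), 0%R. split; [rewrite Cmod_0; exact Hrho|reflexivity]. }
  apply NNPP. intros HN.
  assert (Hlt : forall z, Cmod z <= rho -> u z < s).
  { intros z Hz. destruct (Rle_lt_dec s (u z)) as [H|H]; [|exact H].
    exfalso. apply HN. exists z. split; [exact Hz|]. intros w Hw.
    apply Rle_trans with s; [|exact H]. apply Hs1. exists w. auto. }
  (* A supremum [s] that is not attained leaves a gap at each point, hence a uniform gap [d1],
     against the minimality of [s]. *)
  destruct (closed_disk_compact (fun z d => u z <= s - d) rho) as [d1 [Hd1 Hb1]].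
  { intros z d d' H Hd'. lra. }
  { intros z Hz. assert (Hlz := Hlt z Hz).
    destruct (Hc z Hz ((s - u z) / 2)) as [d [Hd H]]; [lra|].
    exists (Rmin d ((s - u z) / 2)). split; [apply Rmin_pos; lra|].
    intros w _ Hw.
    assert (H1 : Cmod (w - z)%C < d) by (eapply Rlt_le_trans; [exact Hw|apply Rmin_l]).
    specialize (H w H1). assert (H2 := Rmin_r d ((s - u z) / 2)). lra. }
  assert (s <= s - d1); [|lra].
  apply Hs2. intros x [z [Hz ->]]. apply Hb1, Hz.
Qed.

Lemma lipschitz_at_sqr u z : lipschitz_at u z -> lipschitz_at (fun w => u w ^ 2) z.
Proof.
  intros [L [d [HL [Hd H]]]].
  exists (L * (2 * Rabs (u z) + L * d)), d.
  assert (HA := Rabs_pos (u z)).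
  assert (HLd : 0 <= L * d) by (apply Rmult_le_pos; lra).
  split; [apply Rmult_le_pos; lra|]. split; [exact Hd|].
  intros w Hw. specialize (H w Hw). assert (Hm := Cmod_ge_0 (w - z)%C).
  replace (u w ^ 2 - u z ^ 2) with ((u w - u z) * (u w - u z + 2 * u z)) by ring.
  rewrite Rabs_mult.
  replace (L * (2 * Rabs (u z) + L * d) * Cmod (w - z)) with
    ((L * Cmod (w - z)%C) * (2 * Rabs (u z) + L * d)) by ring.
  apply Rmult_le_compat; try apply Rabs_pos; [exact H|].
  eapply Rle_trans; [apply Rabs_triang|].
  rewrite Rabs_mult, (Rabs_pos_eq 2) by lra.
  assert (L * Cmod (w - z)%C <= L * d) by (apply Rmult_le_compat_l; lra). lra.
Qed.

Lemma lipschitz_at_plus_scal u v e z : lipschitz_at u z -> lipschitz_at v z ->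
  lipschitz_at (fun w => u w + e * v w) z.
Proof.
  intros [L [d [HL [Hd H]]]] [L' [d' [HL' [Hd' H']]]].
  assert (He := Rabs_pos e).
  exists (L + Rabs e * L'), (Rmin d d').
  split; [assert (0 <= Rabs e * L') by (apply Rmult_le_pos; lra); lra|].
  split; [apply Rmin_pos; assumption|]. intros w Hw.
  specialize (H w (Rlt_le_trans _ _ _ Hw (Rmin_l _ _))).
  specialize (H' w (Rlt_le_trans _ _ _ Hw (Rmin_r _ _))).
  replace (u w + e * v w - (u z + e * v z)) with ((u w - u z) + e * (v w - v z)) by ring.
  eapply Rle_trans; [apply Rabs_triang|]. rewrite Rabs_mult.
  assert (Rabs e * Rabs (v w - v z) <= Rabs e * (L' * Cmod (w - z)%C))
    by (apply Rmult_le_compat_l; lra). lra.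
Qed.

Lemma Cmod_sub_abs (z w : C) : Rabs (Cmod z - Cmod w) <= Cmod (z - w)%C.
Proof.
  apply Rabs_le. assert (H1 := Cmod_sub_ge z (- w)%C). assert (H2 := Cmod_sub_ge w (z - w)%C).
  rewrite Cmod_opp in H1. replace (w + (z - w))%C with z in H2 by ring.
  change (z + - w)%C with (z - w)%C in H1.
  assert (H3 := Cmod_triangle z (- w)). assert (H4 := Cmod_sub_ge w (- z)%C).
  rewrite Cmod_opp in H4. replace (w + - z)%C with (- (z - w))%C in H4 by ring.
  rewrite Cmod_opp in H4. lra.
Qed.

Lemma lipschitz_at_Cmod z : lipschitz_at Cmod z.
Proof.
  exists 1, 1. split; [lra|]. split; [lra|]. intros w _.
  rewrite Rmult_1_l. apply Cmod_sub_abs.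
Qed.

Lemma lipschitz_at_expands2 g z a b c : expands2 g z a b c -> lipschitz_at (fun w => Cmod (g w)) z.
Proof.
  intros H. assert (Hv := expands2_value _ _ _ _ _ H).
  destruct H as [k [Hk [d [Hd H]]]].
  assert (HB : bounded_near0 (fun t => b + c * t + t * (t * k t))%C) by solve_bounded_near0.
  destruct HB as [M [d' [Hd' HM]]].
  exists (Rabs M), (Rmin d d').
  split; [apply Rabs_pos|]. split; [apply Rmin_pos; assumption|]. intros w Hw.
  specialize (H _ (Rlt_le_trans _ _ _ Hw (Rmin_l _ _))).
  specialize (HM _ (Rlt_le_trans _ _ _ Hw (Rmin_r _ _))).
  rewrite <- C_sub_add in H.
  eapply Rle_trans; [apply Cmod_sub_abs|]. rewrite H, Hv.
  match goal with |- Cmod ?x <= _ => replace x with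
   ((b + c * (w - z) + (w - z) * ((w - z) * k (w - z))) * (w - z))%C by ring end.
  rewrite Cmod_mult. apply Rmult_le_compat_r; [apply Cmod_ge_0|].
  eapply Rle_trans; [exact HM|apply Rle_abs].
Qed.

Lemma Cmod_sqr_plus_ge (q r : C) : Cmod q ^ 2 - 2 * Cmod q * Cmod r <= Cmod (q + r)%C ^ 2.
Proof.
  assert (H1 := Cmod_ge_0 q). assert (H2 := Cmod_ge_0 r).
  assert (H3 := Cmod_ge_0 (q + r)%C). assert (H4 := Cmod_sub_ge q r).
  destruct (Rle_lt_dec (Cmod q) (Cmod r)); nra.
Qed.

(* At an interior maximum of [|g|^2 + eps |z|^2], averaging over the four points
   [z0 + i^k s] kills the terms [b t] and [c t^2] of the expansion and leaves a
   gain of at least [eps s^2 - O(s^3)]. *)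
Lemma no_interior_max g z0 a b c eps d : expands2 g z0 a b c -> 0 < eps -> 0 < d ->
  ~ (forall t, Cmod t < d ->
       Cmod (g (z0 + t)%C) ^ 2 + eps * Cmod (z0 + t)%C ^ 2 <= Cmod (g z0) ^ 2 + eps * Cmod z0 ^ 2).
Proof.
  intros H Heps Hd Hmax. assert (Hv := expands2_value _ _ _ _ _ H).
  destruct H as [k [[M [d1 [Hd1 HM]]] [d2 [Hd2 H]]]].
  set (Q := Cmod a + Cmod b + Cmod c).
  assert (Ha := Cmod_ge_0 a). assert (Hb := Cmod_ge_0 b). assert (Hc := Cmod_ge_0 c).
  assert (HM0 : 0 <= M).
  { eapply Rle_trans; [apply Cmod_ge_0|apply (HM (RtoC 0))]. rewrite Cmod_0. exact Hd1. }
  assert (HQM : 0 <= Q * M) by (apply Rmult_le_pos; unfold Q; lra).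
  (* [Q] bounds the quadratic part for [s <= 1], so dropping the remainder costs at most [2 Q M s^3]
     at each of the four points. This [s] makes the cost smaller than the gain [eps s^2]. *)
  set (s := Rmin (Rmin 1 (Rmin d (Rmin d1 d2)) / 2) (eps / (2 * (Q * M) + 1) / 2)).
  assert (Hs0 : 0 < s).
  { unfold s. repeat apply Rmin_pos; try lra.
    - apply Rdiv_lt_0_compat; [|lra]. repeat apply Rmin_pos; lra.
    - apply Rdiv_lt_0_compat; [|lra]. apply Rdiv_lt_0_compat; lra. }
  assert (Hs1 : s < Rmin 1 (Rmin d (Rmin d1 d2))).
  { apply Rle_lt_trans with (Rmin 1 (Rmin d (Rmin d1 d2)) / 2); [apply Rmin_l|].
    assert (0 < Rmin 1 (Rmin d (Rmin d1 d2))) by (repeat apply Rmin_pos; lra). lra. }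
  assert (Hs2 : s * (2 * (Q * M) + 1) < eps).
  { apply Rle_lt_trans with (eps / (2 * (Q * M) + 1) / 2 * (2 * (Q * M) + 1)).
    - apply Rmult_le_compat_r; [lra|apply Rmin_r].
    - replace (eps / (2 * (Q * M) + 1) / 2 * (2 * (Q * M) + 1)) with (eps / 2) by (field; lra). lra. }
  assert (B1 := Rlt_le_trans _ _ _ Hs1 (Rmin_l _ _)).
  assert (Hs3 := Rlt_le_trans _ _ _ Hs1 (Rmin_r _ _)).
  assert (B2 := Rlt_le_trans _ _ _ Hs3 (Rmin_l _ _)).
  assert (Hs4 := Rlt_le_trans _ _ _ Hs3 (Rmin_r _ _)).
  assert (B3 := Rlt_le_trans _ _ _ Hs4 (Rmin_l _ _)).
  assert (B4 := Rlt_le_trans _ _ _ Hs4 (Rmin_r _ _)).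
  assert (Key : forall t, Cmod t = s ->
    Cmod (a + b * t + c * t ^ 2)%C ^ 2 - 2 * (Q * M) * s ^ 3 + eps * Cmod (z0 + t)%C ^ 2
      <= Cmod a ^ 2 + eps * Cmod z0 ^ 2).
  { intros t Ht. rewrite Hv in Hmax. eapply Rle_trans; [|apply (Hmax t); lra].
    apply Rplus_le_compat_r. rewrite (H t) by lra.
    eapply Rle_trans; [|apply Cmod_sqr_plus_ge].
    assert (Hq : Cmod (a + b * t + c * t ^ 2)%C <= Q).
    { unfold Q. eapply Rle_trans; [apply Cmod_triangle|]. apply Rplus_le_compat.
      - eapply Rle_trans; [apply Cmod_triangle|]. rewrite Cmod_mult, Ht. nra.
      - rewrite Cmod_mult, Cmod_pow, Ht. assert (s ^ 2 <= 1) by nra. nra. }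
    assert (Hr : Cmod (t ^ 3 * k t)%C <= M * s ^ 3).
    { rewrite Cmod_mult, Cmod_pow, Ht, Rmult_comm. apply Rmult_le_compat_r.
      - apply pow_le; lra.
      - apply HM. lra. }
    assert (Hqr : Cmod (a + b * t + c * t ^ 2)%C * Cmod (t ^ 3 * k t)%C <= Q * (M * s ^ 3)).
    { apply Rmult_le_compat; auto using Cmod_ge_0. }
    lra. }
  assert (N1 : Cmod (RtoC s) = s) by (rewrite Cmod_R, Rabs_pos_eq; lra).
  assert (N2 : Cmod (Ci * s)%C = s) by (rewrite Cmod_mult, Cmod_Ci, N1; ring).
  assert (K1 := Key (RtoC s) N1).
  assert (K2 := Key (Ci * s)%C N2).
  assert (K3 := Key (- s)%C ltac:(rewrite Cmod_opp; exact N1)).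
  assert (K4 := Key (- (Ci * s))%C ltac:(rewrite Cmod_opp; exact N2)).
  rewrite !Cmod2_alt in K1, K2, K3, K4.
  destruct a as [a1 a2], b as [b1 b2], c as [c1 c2], z0 as [x y]. simpl in *.
  ring_simplify in K1. ring_simplify in K2. ring_simplify in K3. ring_simplify in K4.
  (* The squared moduli of the quadratic part average to [|a|^2 + |b|^2 s^2 + |c|^2 s^4]; the last
     two terms only help. *)
  assert (0 <= b1 ^ 2 * s ^ 2) by nra. assert (0 <= b2 ^ 2 * s ^ 2) by nra.
  assert (0 <= c1 ^ 2 * s ^ 4) by nra. assert (0 <= c2 ^ 2 * s ^ 4) by nra.
  assert (F : 4 * eps * s ^ 2 <= 4 * (2 * (Q * M) * s ^ 3)) by nra.
  assert (G : s ^ 2 * (s * (2 * (Q * M) + 1)) < s ^ 2 * eps) by (apply Rmult_lt_compat_l; nra).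
  assert (0 < s ^ 3) by (apply pow_lt; lra).
  nra.
Qed.

Lemma maximum_principle (g : C -> C) (rho K : R) : 0 < rho ->
  (forall z, Cmod z <= rho -> exists a b c, expands2 g z a b c) ->
  (forall z, Cmod z = rho -> Cmod (g z) <= K) ->
  forall z, Cmod z <= rho -> Cmod (g z) <= K.
Proof.
  intros Hrho Hg HK z Hz.
  assert (HK0 : 0 <= K).
  { eapply Rle_trans; [apply Cmod_ge_0|apply (HK (RtoC rho))].
    rewrite Cmod_R, Rabs_pos_eq; lra. }
  assert (Hsq : Cmod (g z) ^ 2 <= K ^ 2).
  { apply le_epsilon. intros e He.
    (* On the circle the perturbation [eps |z|^2] is exactly [e]: it forces the maximum to the
       boundary at the price of [e] in the bound. *)
    set (eps := e / rho ^ 2).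
    assert (Hr2 : 0 < rho ^ 2) by (apply pow_lt; lra).
    assert (Heps : 0 < eps) by (apply Rdiv_lt_0_compat; lra).
    destruct (closed_disk_max (fun w => Cmod (g w) ^ 2 + eps * Cmod w ^ 2) rho) as [z0 [Hz0 Hmax]].
    - lra.
    - intros w Hw. destruct (Hg w Hw) as [a [b [c H]]].
      apply (lipschitz_at_plus_scal (fun w => Cmod (g w) ^ 2) (fun w => Cmod w ^ 2)).
      + apply (lipschitz_at_sqr (fun w => Cmod (g w))). eapply lipschitz_at_expands2. exact H.
      + apply lipschitz_at_sqr, lipschitz_at_Cmod.
    - assert (Hb : Cmod z0 = rho).
      { destruct (Rle_lt_or_eq_dec _ _ Hz0) as [Hlt|]; [|assumption]. exfalso.
        destruct (Hg z0 Hz0) as [a [b [c H]]].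
        apply (no_interior_max g z0 a b c eps (rho - Cmod z0) H); try lra.
        intros t Ht. apply Hmax. eapply Rle_trans; [apply Cmod_triangle|lra]. }
      specialize (Hmax z Hz). rewrite Hb in Hmax. specialize (HK z0 Hb).
      assert (H1 : Cmod (g z0) ^ 2 <= K ^ 2) by (apply pow_incr; split; [apply Cmod_ge_0|exact HK]).
      assert (H2 : 0 <= eps * Cmod z ^ 2) by (apply Rmult_le_pos; [lra|apply pow_le, Cmod_ge_0]).
      assert (H3 : eps * rho ^ 2 = e) by (unfold eps; field; lra).
      lra. }
  assert (H := Cmod_ge_0 (g z)).
  destruct (Rle_lt_dec (Cmod (g z)) K); [assumption|nra].
Qed.

(** * Power series of functions in the class, and Schwarz's lemma *)

Lemma pow_n_Cpow (z : C) n : pow_n (K := C_AbsRing) z n = (z ^ n)%C.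
Proof. induction n; [reflexivity|]. simpl. rewrite IHn. reflexivity. Qed.

Lemma is_pseries_csum (a : nat -> C) z l :
  is_pseries (K := C_AbsRing) (V := C_NormedModule) a z l <-> csum (fun n => a n * z ^ n)%C l.
Proof.
  rewrite csum_is_series. unfold is_pseries.
  assert (E : forall n, scal (V := C_NormedModule) (pow_n (K := C_AbsRing) z n) (a n) = (a n * z ^ n)%C).
  { intros n. change (pow_n (K := C_AbsRing) z n * a n = a n * z ^ n)%C.
    rewrite (pow_n_Cpow z n). ring. }
  split; apply is_series_ext; intros n; [apply E|symmetry; apply E].
Qed.

Lemma psum_0 a : psum a (RtoC 0) = a 0%nat.
Proof.
  apply csum_cseries. replace (a 0%nat) with (0 + a 0%nat * 0 ^ 0)%C at 1 by (simpl; ring).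
  apply (csum_decr_1 (fun n => a n * 0 ^ n)%C).
  destruct (csum_dominated (fun n => a (S n) * 0 ^ S n)%C 0 0) as [H1 H2]; [lra| |].
  - intros n. rewrite Cpow_S, !Cmod_mult, Cmod_0. lra.
  - rewrite (Cmod_eq_0 (cseries (fun n => a (S n) * 0 ^ S n)%C)) in H1; [exact H1|].
    assert (H := Cmod_ge_0 (cseries (fun n => a (S n) * 0 ^ S n)%C)). lra.
Qed.

Lemma psum_shift a z : disk_coeffs a -> disk_coeffs (fun n => a (S n)) -> Cmod z < 1 ->
  psum a z = (a 0%nat + z * psum (fun n => a (S n)) z)%C.
Proof.
  intros Ha Hs Hz. apply csum_cseries.
  replace (a 0%nat + z * psum (fun n => a (S n)) z)%C
    with (z * psum (fun n => a (S n)) z + a 0%nat * z ^ 0)%C by (simpl; ring).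
  apply (csum_decr_1 (fun n => a n * z ^ n)%C).
  apply csum_ext with (fun n => z * (a (S n) * z ^ n))%C; [intros n; simpl; ring|].
  apply csum_scal, psum_csum; assumption.
Qed.

Lemma disk_coeffs_shift a : disk_coeffs a -> disk_coeffs (fun n => a (S n)).
Proof.
  intros Ha rho Hr. destruct (Ha rho Hr) as [M HM]. exists (M / rho). intros n.
  specialize (HM (S n)). simpl in HM. apply Rmult_le_reg_r with rho; [lra|].
  replace (M / rho * rho) with M by (field; lra). lra.
Qed.

Lemma class_A_psum f : class_A f -> exists c, disk_coeffs c /\ c 0%nat = RtoC 1 /\
  forall z, Cmod z < 1 -> f z = (z * psum c z)%C.
Proof.
  intros [_ [a [H0 [H1 H]]]].
  assert (Ha : disk_coeffs a).
  { apply disk_coeffs_of_csum with f. intros z Hz. apply is_pseries_csum, H, Hz. }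
  exists (fun n => a (S n)). split; [apply disk_coeffs_shift, Ha|]. split; [exact H1|].
  intros z Hz. transitivity (psum a z).
  - symmetry. apply csum_cseries, is_pseries_csum, H, Hz.
  - rewrite psum_shift, H0; [ring| |exact (disk_coeffs_shift a Ha)|exact Hz]; assumption.
Qed.

Lemma is_derive_id_mult_psum c z : disk_coeffs c -> Cmod z < 1 ->
  is_C_derive (fun z => z * psum c z)%C z
    (psum c z + z * psum (dcoeffs c) z)%C.
Proof.
  intros Hc Hz. destruct (psum_expands c z Hc Hz) as [c2 H].
  assert (HM := expands2_mult _ _ _ _ _ _ _ _ _ (expands2_id z) H).
  apply expands2_derive in HM.
  replace (psum c z + z * psum (dcoeffs c) z)%C
    with (z * psum (dcoeffs c) z + 1 * psum c z)%C by ring. exact HM.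
Qed.

Lemma is_derive_ext_disk (f g : C -> C) z l : Cmod z < 1 ->
  (forall w, Cmod w < 1 -> f w = g w) ->
  is_C_derive g z l ->
  is_C_derive f z l.
Proof.
  intros Hz E. rewrite !is_derive_C_eps. intros H eps Heps.
  destruct (H eps Heps) as [d [Hd HH]].
  exists (Rmin d (1 - Cmod z)). split; [apply Rmin_pos; lra|].
  intros t Ht. assert (H1 := Rlt_le_trans _ _ _ Ht (Rmin_l _ _)).
  assert (H2 := Rlt_le_trans _ _ _ Ht (Rmin_r _ _)).
  rewrite !E; [apply HH, H1|exact Hz|].
  eapply Rle_lt_trans; [apply Cmod_triangle|lra].
Qed.

Lemma class_A_id_mult_psum c : disk_coeffs c -> c 0%nat = RtoC 1 -> class_A (fun z => z * psum c z)%C.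
Proof.
  intros Hc H0. split.
  - intros z Hz. eexists. apply is_derive_id_mult_psum; assumption.
  - exists (fun n => match n with O => RtoC 0 | S n => c n end). split; [reflexivity|].
    split; [exact H0|]. intros z Hz. apply is_pseries_csum.
    replace (z * psum c z)%C with (z * psum c z + 0 * z ^ 0)%C by (simpl; ring).
    apply (csum_decr_1 (fun n => match n with O => RtoC 0 | S n => c n end * z ^ n)%C).
    apply csum_ext with (fun n => z * (c n * z ^ n))%C; [intros n; simpl; ring|].
    apply csum_scal, psum_csum; assumption.
Qed.

Lemma class_A_0 f : class_A f -> f (RtoC 0) = RtoC 0.
Proof.
  intros Hf. destruct (class_A_psum f Hf) as [c [_ [_ E]]].
  rewrite E; [ring|rewrite Cmod_0; lra].
Qed.

(* With [f = z F] one has [w = z h] for the quotient [h] below, so the maximum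
   principle applies to [h] without discussing the removable singularity of [w / z]. *)
Lemma janowski_schwarz A B f w : -1 <= B -> B < A -> A <= 1 -> class_S f ->
  (forall z, Cmod z < 1 -> Cmod (w z) < 1) ->
  (forall z, Cmod z < 1 -> zf'_over_f f z = ((1 + RtoC A * w z) / (1 + RtoC B * w z))%C) ->
  w (RtoC 0) = RtoC 0 ->
  forall z, Cmod z < 1 -> Cmod (w z) <= Cmod z.
Proof.
  intros HB HBA HA [Hf Hu] Hw Hsub Hw0.
  destruct (class_A_psum f Hf) as [c [Hc [Hc0 E]]].
  assert (Hf0 := class_A_0 f Hf).
  set (F := psum c). set (F' := psum (dcoeffs c)).
  (* Since [z f' / f = 1 + z F' / F], equating this with [(1 + A w) / (1 + B w)] and solving for [w]
     gives [w N = z F']. *)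
  set (N := fun z => ((RtoC A - RtoC B) * F z + - RtoC B * (z * F' z))%C).
  assert (HFn : forall z, Cmod z < 1 -> F z <> RtoC 0).
  { intros z Hz HF. destruct (Ceq_dec z (RtoC 0)) as [->|Hz0].
    - unfold F in HF. rewrite psum_0, Hc0 in HF. apply RtoC_inj in HF. lra.
    - apply Hz0. apply Hu; [exact Hz|unfold unit_disk; rewrite Cmod_0; lra|].
      rewrite Hf0, E by exact Hz. fold F. rewrite HF. ring. }
  assert (HBw : forall z, Cmod z < 1 -> (1 + RtoC B * w z)%C <> RtoC 0).
  { intros z Hz. apply Cmod_gt_0.
    eapply Rlt_le_trans; [|apply Cmod_sub_ge]. rewrite Cmod_1, Cmod_mult, Cmod_R.
    specialize (Hw z Hz). assert (H := Cmod_ge_0 (w z)).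
    assert (Rabs B <= 1) by (apply Rabs_le; lra). assert (H1 := Rabs_pos B). nra. }
  assert (Hrel : forall z, Cmod z < 1 -> (w z * N z = z * F' z)%C).
  { intros z Hz. destruct (Ceq_dec z (RtoC 0)) as [->|Hz0].
    - rewrite Hw0. ring.
    - specialize (Hsub z Hz). unfold zf'_over_f in Hsub.
      destruct (Ceq_dec z 0) as [|_]; [contradiction|].
      assert (HD : C_derive f z = (F z + z * F' z)%C).
      { apply is_C_derive_unique. apply is_derive_ext_disk with (fun z => z * psum c z)%C; auto.
        apply is_derive_id_mult_psum; assumption. }
      rewrite HD, E in Hsub by exact Hz. fold F in Hsub.
      specialize (HFn z Hz). specialize (HBw z Hz). unfold N.
      assert (H1 : ((F z + z * F' z) * (1 + RtoC B * w z) = (1 + RtoC A * w z) * F z)%C).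
      { replace ((F z + z * F' z) * (1 + RtoC B * w z))%C with
          (z * (F z + z * F' z) / (z * F z) * (F z * (1 + RtoC B * w z)))%C.
        - rewrite Hsub. field. assumption.
        - field. split; assumption. }
      replace (w z * ((A - B) * F z + - B * (z * F' z)))%C with
        ((1 + RtoC A * w z) * F z - (F z + z * F' z) * (1 + RtoC B * w z) + z * F' z)%C by ring.
      rewrite H1. ring. }
  (* A zero of [N] would be a zero of [z F'] by the relation, hence of [(A - B) F]; but [F] has no
     zeros, by univalence and [F 0 = 1]. *)
  assert (HNn : forall z, Cmod z < 1 -> N z <> RtoC 0).
  { intros z Hz HN. assert (H1 := Hrel z Hz). rewrite HN in H1.
    assert (H2 : (z * F' z = 0)%C) by (rewrite <- H1; ring).
    unfold N in HN. rewrite H2 in HN.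
    assert (H3 : ((RtoC A - RtoC B) * F z = 0)%C) by (rewrite <- HN; ring).
    revert H3. apply Cmult_neq_0; [|exact (HFn z Hz)].
    rewrite <- RtoC_minus. intros H3. apply RtoC_inj in H3. lra. }
  set (h := fun z => (F' z * / N z)%C).
  assert (Hwh : forall z, Cmod z < 1 -> w z = (z * h z)%C).
  { intros z Hz. unfold h. specialize (HNn z Hz). specialize (Hrel z Hz).
    replace (z * (F' z * / N z))%C with (z * F' z * / N z)%C by ring.
    rewrite <- Hrel. field. assumption. }
  assert (Hexp : forall z, Cmod z < 1 -> exists a b d, expands2 h z a b d).
  { intros z Hz.
    destruct (psum_expands c z Hc Hz) as [c2 H1].
    destruct (psum_expands (dcoeffs c) z (disk_coeffs_derive c Hc) Hz) as [c3 H2].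
    assert (H3 := expands2_plus _ _ _ _ _ _ _ _ _
      (expands2_scal (RtoC A - RtoC B)%C _ _ _ _ _ H1)
      (expands2_scal (- RtoC B)%C _ _ _ _ _ (expands2_mult _ _ _ _ _ _ _ _ _ (expands2_id z) H2))).
    destruct (fun Hn => expands2_inv N z _ _ _ Hn H3) as [a' [b' [c' H4]]].
    - exact (HNn z Hz).
    - eexists. eexists. eexists. exact (expands2_mult _ _ _ _ _ _ _ _ _ H2 H4). }
  assert (Hh : forall z, Cmod z < 1 -> Cmod (h z) <= 1).
  { intros z Hz. assert (Hz0 := Cmod_ge_0 z).
    apply le_epsilon. intros e He.
    (* A circle beyond [z], so close to the unit circle that [|h| = |w| / rho < 1 / rho <= 1 + e] on
       it. *)
    set (rho := Rmax ((1 + Cmod z) / 2) (/ (1 + e))).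
    assert (Hie : / (1 + e) < 1) by (rewrite <- Rinv_1; apply Rinv_lt_contravar; lra).
    assert (Hr : Cmod z < rho < 1).
    { unfold rho. split.
      - eapply Rlt_le_trans; [|apply Rmax_l]. lra.
      - apply Rmax_lub_lt; lra. }
    apply (maximum_principle h rho (1 + e)); try lra.
    - intros y Hy. apply Hexp. lra.
    - intros y Hy. assert (Hy1 : Cmod y < 1) by lra.
      assert (H1 := Hw y Hy1). rewrite Hwh in H1 by exact Hy1.
      rewrite Cmod_mult, Hy in H1.
      assert (H2 : / (1 + e) <= rho) by apply Rmax_r.
      assert (H3 : 1 <= rho * (1 + e)).
      { apply Rle_trans with (/ (1 + e) * (1 + e)).
        - apply Req_le. field. lra.
        - apply Rmult_le_compat_r; lra. }
      apply Rmult_le_reg_l with rho; lra. }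
  intros z Hz. rewrite Hwh by exact Hz. rewrite Cmod_mult.
  specialize (Hh z Hz). assert (H := Cmod_ge_0 z). nra.
Qed.

(** * Exponential and logarithm *)

Lemma Cexp_plus (z w : C) : Cexp (z + w)%C = (Cexp z * Cexp w)%C.
Proof.
  destruct z as [x y], w as [u v]. unfold Cexp. simpl.
  rewrite exp_plus, cos_plus, sin_plus. apply C_ext; simpl; ring.
Qed.

Lemma Cexp_0 : Cexp (RtoC 0) = RtoC 1.
Proof. unfold Cexp. simpl. rewrite exp_0, cos_0, sin_0. apply C_ext; simpl; ring. Qed.

Lemma Cexp_opp_r (z : C) : (Cexp z * Cexp (- z) = 1)%C.
Proof. rewrite <- Cexp_plus, <- Cexp_0. f_equal. ring. Qed.

Lemma Cexp_neq_0 (z : C) : Cexp z <> RtoC 0.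
Proof.
  intros H. assert (H1 := Cexp_opp_r z). rewrite H, Cmult_0_l in H1.
  apply RtoC_inj in H1. lra.
Qed.

Lemma Cmod_Cexp (z : C) : Cmod (Cexp z) = exp (Re z).
Proof.
  assert (H := Cmod2_alt (Cexp z)). unfold Cexp in H at 2 3. simpl Re in H. simpl Im in H.
  assert (E := sin2_cos2 (Im z)). unfold Rsqr in E.
  assert (H1 : Cmod (Cexp z) ^ 2 = exp (Re z) ^ 2).
  { rewrite H. replace (exp (Re z) ^ 2) with (exp (Re z) ^ 2 * (sin (Im z) * sin (Im z) + cos (Im z) * cos (Im z)))
      by (rewrite E; ring). ring. }
  assert (H2 := Cmod_ge_0 (Cexp z)). assert (H3 := exp_pos (Re z)). nra.
Qed.

Lemma exp_taylor1 x : Rabs x <= 1 / 2 -> Rabs (exp x - 1 - x) <= 2 * x ^ 2.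
Proof.
  intros Hx. apply Rabs_le_between in Hx.
  assert (H1 := exp_ineq1_le x). assert (H2 := exp_ineq1_le (- x)).
  assert (H3 : exp x * exp (- x) = 1) by (rewrite <- exp_plus, Rplus_opp_r; apply exp_0).
  assert (H4 := exp_pos x). rewrite Rabs_pos_eq by lra.
  assert (exp x * (1 - x) <= 1) by nra. nra.
Qed.

Lemma Rabs_sin_le y : Rabs (sin y) <= Rabs y.
Proof.
  assert (Hp : forall y, 0 < y -> Rabs (sin y) <= y).
  { intros x Hx. assert (H1 := sin_lt_x x Hx).
    destruct (Rle_lt_dec x 1) as [H|H].
    - assert (0 <= sin x) by (apply sin_ge_0; assert (H2 := PI2_1); lra).
      rewrite Rabs_pos_eq; lra.
    - assert (H2 := SIN_bound x). apply Rabs_le. lra. }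
  destruct (Rtotal_order y 0) as [H|[->|H]].
  - rewrite <- (Ropp_involutive y) at 1. rewrite sin_neg, Rabs_Ropp, (Rabs_left y) by lra.
    apply Hp. lra.
  - rewrite sin_0. lra.
  - rewrite (Rabs_pos_eq y) by lra. apply Hp, H.
Qed.

Lemma one_sub_cos_bound y : 0 <= 1 - cos y <= y ^ 2 / 2.
Proof.
  assert (H := cos_2a_sin (y / 2)). replace (2 * (y / 2)) with y in H by field.
  assert (H1 := Rabs_sin_le (y / 2)).
  assert (H2 : sin (y / 2) ^ 2 <= (y / 2) ^ 2).
  { rewrite <- (pow2_abs (sin (y / 2))), <- (pow2_abs (y / 2)).
    apply pow_incr. split; [apply Rabs_pos|exact H1]. }
  rewrite H. nra.
Qed.

Lemma ex_derive_continuity_pt (f : R -> R) x : ex_derive f x -> continuity_pt f x.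
Proof. intros H. apply derivable_continuous_pt, ex_derive_Reals_0, H. Qed.

(** The inequality [y <= tan y] freed of the division, which extends it up to [PI]. *)
Lemma mult_cos_le_sin y : 0 <= y <= PI -> y * cos y <= sin y.
Proof.
  intros Hy.
  destruct (MVT_gen (fun x => sin x - x * cos x) 0 y (fun x => x * sin x)) as [c [Hc Hm]].
  - intros x _. auto_derive; [exact I|ring].
  - intros x _. apply ex_derive_continuity_pt. auto_derive. exact I.
  - rewrite Rmin_left, Rmax_right in Hc by lra.
    rewrite sin_0, cos_0 in Hm.
    assert (Hs : 0 <= sin c) by (apply sin_ge_0; lra).
    assert (0 <= c * sin c * (y - 0)) by (repeat apply Rmult_le_pos; lra). lra.
Qed.

Lemma sin_taylor1 y : Rabs y <= 1 -> Rabs (sin y - y) <= y ^ 2.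
Proof.
  assert (Hp : forall y, 0 <= y <= 1 -> Rabs (sin y - y) <= y ^ 2).
  { intros x Hx. assert (HPI := PI2_1).
    assert (H1 := mult_cos_le_sin x ltac:(lra)). assert (H2 := one_sub_cos_bound x).
    assert (H3 := Rabs_sin_le x). rewrite (Rabs_pos_eq x) in H3 by lra.
    apply Rabs_le_between in H3. apply Rabs_le. nra. }
  intros Hy. apply Rabs_le_between in Hy. destruct (Rle_lt_dec 0 y) as [H|H].
  - apply Hp. lra.
  - replace (sin y - y) with (- (sin (- y) - - y)) by (rewrite sin_neg; ring).
    rewrite Rabs_Ropp. replace (y ^ 2) with ((- y) ^ 2) by ring. apply Hp. lra.
Qed.

Lemma Cexp_taylor1 (t : C) : Cmod t <= 1 / 2 -> Cmod (Cexp t - 1 - t)%C <= 20 * Cmod t ^ 2.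
Proof.
  intros Ht. assert (H0 := Cmod_ge_0 t).
  assert (Hx := re_le_Cmod t). assert (Hy := im_le_Cmod t).
  assert (Hsq := Cmod2_alt t).
  destruct t as [x y]. simpl in Hx, Hy, Hsq. set (m := Cmod (x, y)) in *.
  assert (E1 := exp_taylor1 x ltac:(lra)).
  assert (E2 := one_sub_cos_bound y).
  assert (E3 := sin_taylor1 y ltac:(lra)).
  eapply Rle_trans; [apply Cmod_le_re_im|]. simpl.
  assert (Hex : 0 < exp x <= 3).
  { split; [apply exp_pos|]. apply Rle_trans with (exp 1); [|apply exp_le_3].
    left. apply exp_increasing. apply Rabs_le_between in Hx. lra. }
  assert (A : Rabs (exp x * cos y + - (1) + - x) <= 4 * m ^ 2).
  { replace (exp x * cos y + - (1) + - x) with ((exp x - 1 - x) + - (exp x * (1 - cos y))) by ring.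
    eapply Rle_trans; [apply Rabs_triang|]. rewrite Rabs_Ropp, Rabs_mult, (Rabs_pos_eq (exp x)), (Rabs_pos_eq (1 - cos y)) by lra.
    assert (exp x * (1 - cos y) <= 3 * (y ^ 2 / 2)) by (apply Rmult_le_compat; lra).
    nra. }
  assert (B : Rabs (exp x * sin y + - 0 + - y) <= 10 * m ^ 2).
  { replace (exp x * sin y + - 0 + - y) with (exp x * (sin y - y) + (exp x - 1) * y) by ring.
    eapply Rle_trans; [apply Rabs_triang|]. rewrite !Rabs_mult, (Rabs_pos_eq (exp x)) by lra.
    assert (exp x * Rabs (sin y - y) <= 3 * y ^ 2).
    { apply Rmult_le_compat; try lra. apply Rabs_pos. }
    assert (F : Rabs (exp x - 1) <= 2 * m).
    { replace (exp x - 1) with ((exp x - 1 - x) + x) by ring.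
      eapply Rle_trans; [apply Rabs_triang|]. assert (x ^ 2 = Rabs x ^ 2) by (rewrite pow2_abs; ring).
      assert (G := Rabs_pos x). nra. }
    assert (Rabs (exp x - 1) * Rabs y <= 2 * m * m).
    { apply Rmult_le_compat; auto using Rabs_pos. }
    nra. }
  assert (0 <= m ^ 2) by nra. lra.
Qed.

Lemma is_derive_Cexp (z : C) : is_C_derive Cexp z (Cexp z).
Proof.
  apply is_derive_C_eps. intros eps Heps.
  assert (Hm : 0 < Cmod (Cexp z)) by (apply Cmod_gt_0, Cexp_neq_0).
  exists (Rmin (1 / 2) (eps / (20 * Cmod (Cexp z)))). split.
  { apply Rmin_pos; [lra|]. apply Rdiv_lt_0_compat; lra. }
  intros t Ht. assert (H1 := Rlt_le_trans _ _ _ Ht (Rmin_l _ _)).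
  assert (H2 := Rlt_le_trans _ _ _ Ht (Rmin_r _ _)).
  replace (Cexp (z + t) - Cexp z - Cexp z * t)%C with (Cexp z * (Cexp t - 1 - t))%C
    by (rewrite Cexp_plus; ring).
  rewrite Cmod_mult. assert (H3 := Cexp_taylor1 t ltac:(lra)). assert (H4 := Cmod_ge_0 t).
  apply Rle_trans with (Cmod (Cexp z) * (20 * Cmod t ^ 2)); [apply Rmult_le_compat_l; lra|].
  replace (Cmod (Cexp z) * (20 * Cmod t ^ 2)) with ((20 * Cmod (Cexp z) * Cmod t) * Cmod t) by ring.
  apply Rmult_le_compat_r; [lra|].
  apply Rle_trans with (20 * Cmod (Cexp z) * (eps / (20 * Cmod (Cexp z)))).
  - apply Rmult_le_compat_l; lra.
  - apply Req_le. field. lra.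
Qed.

(* The principal logarithm on [Re z > 0], junk elsewhere. *)
Definition Clog (z : C) : C := (ln (Cmod z), atan (Im z / Re z)).

Lemma Cexp_Clog (z : C) : 0 < Re z -> Cexp (Clog z) = z.
Proof.
  destruct z as [x y]. simpl. intros Hx. unfold Cexp, Clog. simpl.
  assert (Hm : Cmod (x, y) = x * sqrt (1 + Rsqr (y / x))).
  { unfold Cmod. simpl fst. simpl snd. rewrite <- (sqrt_Rsqr x) at 2 by lra.
    rewrite <- sqrt_mult.
    - f_equal. unfold Rsqr. field. lra.
    - apply Rle_0_sqr.
    - assert (H := Rle_0_sqr (y / x)). lra. }
  assert (Hs : 0 < sqrt (1 + Rsqr (y / x))).
  { apply sqrt_lt_R0. assert (H := Rle_0_sqr (y / x)). lra. }
  rewrite exp_ln, Hm, cos_atan, sin_atan by (rewrite Hm; apply Rmult_lt_0_compat; lra).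
  apply C_ext; simpl; field; lra.
Qed.

Lemma Clog_continuous (z : C) : 0 < Re z -> forall eps, 0 < eps -> exists d, 0 < d /\
  forall t : C, Cmod t < d -> Cmod (Clog (z + t) - Clog z)%C < eps.
Proof.
  intros Hz eps Heps.
  assert (Hm : 0 < Cmod z) by (eapply Rlt_le_trans; [exact Hz|]; eapply Rle_trans; [apply Rle_abs|apply re_le_Cmod]).
  assert (H1 : continuous (fun z : R * R => ln (sqrt (fst z ^ 2 + snd z ^ 2))) z).
  { apply continuous_comp; [|apply continuous_ln; exact Hm].
    apply (continuous_comp (V := R_UniformSpace)); [|apply continuous_sqrt].
    apply (continuous_plus (U := prod_UniformSpace R_UniformSpace R_UniformSpace) (V := R_NormedModule) (fun z : R * R => fst z ^ 2) (fun z => snd z ^ 2)).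
    - apply (continuous_comp fst (fun x => x ^ 2)).
      + destruct z. apply continuous_fst.
      + apply (ex_derive_continuous (V := R_NormedModule)). auto_derive. exact I.
    - apply (continuous_comp snd (fun x => x ^ 2)).
      + destruct z. apply continuous_snd.
      + apply (ex_derive_continuous (V := R_NormedModule)). auto_derive. exact I. }
  assert (H2 : continuous (fun z : R * R => atan (snd z / fst z)) z).
  { apply (continuous_comp (V := R_UniformSpace)); [|apply continuous_atan].
    apply (continuous_mult (U := prod_UniformSpace R_UniformSpace R_UniformSpace) (K := R_AbsRing) (fun z : R * R => snd z) (fun z => / fst z)).
    - destruct z. apply continuous_snd.
    - apply (continuous_comp (V := R_UniformSpace)); [destruct z; apply continuous_fst|].
      apply continuous_Rinv.
      change (Re z <> 0). lra. }
  assert (Heps2 : 0 < eps / 2) by lra.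
  assert (L1 := proj1 (filterlim_locally _ _) H1 (mkposreal _ Heps2)).
  assert (L2 := proj1 (filterlim_locally _ _) H2 (mkposreal _ Heps2)).
  destruct L1 as [d1 L1]. destruct L2 as [d2 L2].
  exists (Rmin d1 d2). split; [apply Rmin_pos; apply cond_pos|].
  intros t Ht.
  assert (A1 : Rabs (Re t) < Rmin d1 d2) by (eapply Rle_lt_trans; [apply re_le_Cmod|exact Ht]).
  assert (A2 : Rabs (Im t) < Rmin d1 d2) by (eapply Rle_lt_trans; [apply im_le_Cmod|exact Ht]).
  assert (Hd1 := Rmin_l d1 d2). assert (Hd2 := Rmin_r d1 d2).
  assert (BB : forall d : posreal, Rmin d1 d2 <= d -> ball (M := prod_UniformSpace R_UniformSpace R_UniformSpace) z d (z + t)%C).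
  { intros d Hd. split.
    - change (Rabs (Re z + Re t - Re z) < d). replace (Re z + Re t - Re z) with (Re t) by ring. lra.
    - change (Rabs (Im z + Im t - Im z) < d). replace (Im z + Im t - Im z) with (Im t) by ring. lra. }
  specialize (L1 _ (BB d1 Hd1)). specialize (L2 _ (BB d2 Hd2)).
  eapply Rle_lt_trans; [apply Cmod_le_re_im|].
  change (Rabs (Re (Clog (z + t)) - Re (Clog z)) < eps / 2) in L1.
  change (Rabs (Im (Clog (z + t)) - Im (Clog z)) < eps / 2) in L2.
  change (Rabs (Re (Clog (z + t)) - Re (Clog z)) + Rabs (Im (Clog (z + t)) - Im (Clog z)) < eps). lra.
Qed.

(** If [s] is the increment of [Clog], then [t = z (exp s - 1)], so [s - t / z] is of order [s^2].
    Continuity makes [s] small, and then the same relation bounds [|s|] by a multiple of [|t|]. *)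
Lemma is_derive_Clog (z : C) : 0 < Re z ->
  is_C_derive Clog z (/ z)%C.
Proof.
  intros Hz. apply is_derive_C_eps. intros eps Heps.
  assert (Hm : 0 < Cmod z) by (eapply Rlt_le_trans; [exact Hz|]; eapply Rle_trans; [apply Rle_abs|apply re_le_Cmod]).
  assert (Hz0 : z <> RtoC 0) by (apply Cmod_gt_0; exact Hm).
  (* Below [1 / 40] the error [20 |s|^2] is at most [|s| / 2], whence [|z| |s| <= 2 |t|]; the second
     bound brings the resulting factor [40 |s| / |z|] under [eps]. *)
  destruct (Clog_continuous z Hz (Rmin (1 / 40) (eps * Cmod z / 40))) as [d [Hd H]].
  { apply Rmin_pos; [lra|]. assert (0 < eps * Cmod z) by (apply Rmult_lt_0_compat; lra). lra. }
  exists (Rmin d (Re z)). split; [apply Rmin_pos; assumption|].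
  intros t Ht. assert (T1 := Rlt_le_trans _ _ _ Ht (Rmin_l _ _)).
  assert (T2 := Rlt_le_trans _ _ _ Ht (Rmin_r _ _)).
  specialize (H t T1). set (s := (Clog (z + t) - Clog z)%C) in *.
  assert (S1 := Rlt_le_trans _ _ _ H (Rmin_l _ _)).
  assert (S2 := Rlt_le_trans _ _ _ H (Rmin_r _ _)).
  assert (Hzt : 0 < Re (z + t)%C).
  { assert (HR := re_le_Cmod t). apply Rabs_le_between in HR.
    change (0 < Re z + Re t). lra. }
  assert (Ht' : t = (z * (Cexp s - 1))%C).
  { replace (z * (Cexp s - 1))%C with (z * Cexp s - z)%C by ring.
    rewrite <- (Cexp_Clog z Hz) at 1. rewrite <- Cexp_plus. unfold s.
    replace (Clog z + (Clog (z + t) - Clog z))%C with (Clog (z + t)) by ring.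
    rewrite Cexp_Clog by exact Hzt. ring. }
  assert (HT := Cexp_taylor1 s ltac:(lra)).
  set (q := (Cexp s - 1 - s)%C) in *.
  assert (E1 : (s - / z * t = - q)%C).
  { rewrite Ht'. unfold q. field. exact Hz0. }
  rewrite E1, Cmod_opp.
  assert (Hs0 := Cmod_ge_0 s).
  assert (Hlow : Cmod z * Cmod s <= 2 * Cmod t).
  { rewrite Ht'. rewrite Cmod_mult. replace (Cexp s - 1)%C with (s + q)%C by (unfold q; ring).
    assert (HG := Cmod_sub_ge s q).
    assert (Cmod q <= Cmod s / 2) by nra.
    assert (Cmod z * Cmod s <= Cmod z * (2 * Cmod (s + q)%C)) by (apply Rmult_le_compat_l; lra).
    lra. }
  apply Rle_trans with (20 * Cmod s * (2 * Cmod t / Cmod z)).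
  - eapply Rle_trans; [exact HT|]. replace (20 * Cmod s ^ 2) with (20 * Cmod s * Cmod s) by ring.
    apply Rmult_le_compat_l; [lra|].
    apply Rmult_le_reg_l with (Cmod z); [lra|].
    replace (Cmod z * (2 * Cmod t / Cmod z)) with (2 * Cmod t) by (field; lra). exact Hlow.
  - replace (20 * Cmod s * (2 * Cmod t / Cmod z)) with ((40 * Cmod s / Cmod z) * Cmod t) by (field; lra).
    apply Rmult_le_compat_r; [apply Cmod_ge_0|].
    apply Rmult_le_reg_r with (Cmod z); [lra|].
    replace (40 * Cmod s / Cmod z * Cmod z) with (40 * Cmod s) by (field; lra). lra.
Qed.

(** * Rules for complex derivatives *)

Lemma is_C_derive_AbsRing (g : C -> C) (z l : C) :
  is_derive (K := C_AbsRing) (V := AbsRing_NormedModule C_AbsRing) g z l <-> is_C_derive g z l.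
Proof.
  split.
  (* [C] as a module over itself and [C_NormedModule] agree in the estimate up to conversion; only
     the linearity component has to be rebuilt. *)
  - intros [_ H]. split; [apply is_linear_scal_l|exact H].
  - intros [_ H]. split; [apply is_linear_scal_l|exact H].
Qed.

Lemma is_C_derive_comp (f g : C -> C) z df dg :
  is_C_derive f (g z) df -> is_C_derive g z dg -> is_C_derive (fun w => f (g w)) z (df * dg)%C.
Proof.
  intros Hf Hg. rewrite Cmult_comm. apply is_C_derive_AbsRing in Hg.
  exact (is_derive_comp (K := C_AbsRing) (V := C_NormedModule) f g z df dg Hf Hg).
Qed.

Lemma is_C_derive_mult (f g : C -> C) z df dg :
  is_C_derive f z df -> is_C_derive g z dg ->
  is_C_derive (fun w => f w * g w)%C z (df * g z + f z * dg)%C.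
Proof.
  rewrite <- !is_C_derive_AbsRing. intros Hf Hg.
  exact (is_derive_mult (K := C_AbsRing) f g z df dg Hf Hg Cmult_comm).
Qed.

Lemma is_C_derive_plus (f g : C -> C) z df dg :
  is_C_derive f z df -> is_C_derive g z dg -> is_C_derive (fun w => f w + g w)%C z (df + dg)%C.
Proof. exact (is_derive_plus (K := C_AbsRing) (V := C_NormedModule) f g z df dg). Qed.

Lemma is_C_derive_const (c z : C) : is_C_derive (fun _ => c) z (RtoC 0).
Proof. exact (is_derive_const (K := C_AbsRing) (V := C_NormedModule) c z). Qed.

Lemma is_C_derive_id (z : C) : is_C_derive (fun w => w) z (RtoC 1).
Proof. apply is_C_derive_AbsRing. exact (is_derive_id (K := C_AbsRing) z). Qed.

Lemma ex_C_derive_comp (f g : C -> C) z :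
  ex_C_derive f (g z) -> ex_C_derive g z -> ex_C_derive (fun w => f (g w)) z.
Proof. intros [a Ha] [b Hb]. eexists. apply is_C_derive_comp; eassumption. Qed.

Lemma ex_C_derive_mult (f g : C -> C) z :
  ex_C_derive f z -> ex_C_derive g z -> ex_C_derive (fun w => f w * g w)%C z.
Proof. intros [a Ha] [b Hb]. eexists. apply is_C_derive_mult; eassumption. Qed.

Lemma ex_C_derive_plus (f g : C -> C) z :
  ex_C_derive f z -> ex_C_derive g z -> ex_C_derive (fun w => f w + g w)%C z.
Proof. intros [a Ha] [b Hb]. eexists. apply is_C_derive_plus; eassumption. Qed.

Lemma ex_C_derive_const (c z : C) : ex_C_derive (fun _ => c) z.
Proof. eexists. apply is_C_derive_const. Qed.

Lemma ex_C_derive_id (z : C) : ex_C_derive (fun w => w) z.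
Proof. eexists. apply is_C_derive_id. Qed.

Lemma ex_C_derive_inv (f : C -> C) z : f z <> RtoC 0 -> ex_C_derive f z -> ex_C_derive (fun w => / f w)%C z.
Proof.
  intros Hn Hf. apply (ex_C_derive_comp Cinv f); [|exact Hf].
  destruct (expands2_inv _ _ _ _ _ Hn (expands2_id (f z))) as [a [b [c H]]].
  eexists. eapply expands2_derive. exact H.
Qed.

(** * The image of a disk under the logarithm *)

Lemma sinh_le_mult_cosh x : 0 <= x -> sinh x <= x * cosh x.
Proof.
  intros Hx.
  destruct (MVT_gen (fun x => x * ((exp x + exp (- x)) / 2) - (exp x - exp (- x)) / 2) 0 x
    (fun x => x * ((exp x - exp (- x)) / 2))) as [c [Hc Hm]].
  - intros y _. auto_derive; [exact I|field].
  - intros y _. apply ex_derive_continuity_pt. auto_derive. exact I.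
  - rewrite Rmin_left, Rmax_right in Hc by lra.
    rewrite Ropp_0, exp_0 in Hm. unfold sinh, cosh.
    assert (H : exp (- c) <= exp c).
    { destruct (Req_dec c 0) as [->|Hc0]; [rewrite Ropp_0; lra|].
      left. apply exp_increasing. lra. }
    assert (0 <= c * ((exp c - exp (- c)) / 2) * (x - 0)) by (repeat apply Rmult_le_pos; lra).
    lra.
Qed.

Lemma sinh_ge_0 x : 0 <= x -> 0 <= sinh x.
Proof.
  intros H. unfold sinh. destruct (Req_dec x 0) as [->|Hx]; [rewrite Ropp_0; lra|].
  assert (exp (- x) < exp x) by (apply exp_increasing; lra). lra.
Qed.

Lemma cosh_pos x : 0 < cosh x.
Proof. unfold cosh. assert (H1 := exp_pos x). assert (H2 := exp_pos (- x)). lra. Qed.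

Lemma cosh_opp x : cosh (- x) = cosh x.
Proof. unfold cosh. rewrite Ropp_involutive. lra. Qed.

Lemma cosh_Rabs x : cosh (Rabs x) = cosh x.
Proof. unfold Rabs. destruct Rcase_abs; [apply cosh_opp|reflexivity]. Qed.

Lemma cosh_le x y : 0 <= x <= y -> cosh x <= cosh y.
Proof.
  intros H. destruct (MVT_gen cosh x y sinh) as [c [Hc Hm]].
  - intros z _. apply is_derive_Reals, derivable_pt_lim_cosh.
  - intros z _. apply ex_derive_continuity_pt. eexists. apply is_derive_Reals, derivable_pt_lim_cosh.
  - rewrite Rmin_left, Rmax_right in Hc by lra.
    assert (0 <= sinh c * (y - x)) by (apply Rmult_le_pos; [apply sinh_ge_0|]; lra). lra.
Qed.

(** For fixed [u] the left side decreases in [v] from its value [cosh u] at 0: with [K] the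
    hypotenuse, the sign of its derivative follows from [sinh K <= K cosh K] and
    [v cos v <= sin v]. *)
Lemma cosh_hypot_mult_cos_le u v : 0 <= v < PI / 2 -> cosh (sqrt (u ^ 2 + v ^ 2)) * cos v <= cosh u.
Proof.
  intros Hv.
  set (K := fun x => sqrt (u ^ 2 + x ^ 2)).
  destruct (MVT_gen (fun x => cosh (K x) * cos x) 0 v
    (fun x => sinh (K x) * (x / K x) * cos x - cosh (K x) * sin x)) as [c [Hc Hm]].
  (* For [u = 0] the root [K] is not differentiable at 0; the mean value theorem asks for the
     derivative in the open interval only. *)
  - intros x Hx. rewrite Rmin_left, Rmax_right in Hx by lra.
    assert (Hp : 0 < u ^ 2 + x ^ 2) by nra.
    assert (HK : 0 < K x) by (apply sqrt_lt_R0; exact Hp).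
    assert (DK : is_derive K x (x / K x)).
    { change (is_derive (fun x => sqrt (u ^ 2 + x ^ 2)) x (x / K x)). auto_derive; [exact Hp|].
      match goal with |- context [sqrt ?e] => change (sqrt e) with (K x) end. field. change (K x <> 0). lra. }
    assert (DC : is_derive (fun x => cosh (K x)) x (sinh (K x) * (x / K x))).
    { rewrite Rmult_comm. apply (is_derive_comp cosh K); [|exact DK].
      apply is_derive_Reals, derivable_pt_lim_cosh. }
    replace (sinh (K x) * (x / K x) * cos x - cosh (K x) * sin x) with
      (sinh (K x) * (x / K x) * cos x + cosh (K x) * (- sin x)) by ring.
    apply (is_derive_mult (K := R_AbsRing) (fun x => cosh (K x)) cos); [exact DC| |exact Rmult_comm].
    apply is_derive_Reals, derivable_pt_lim_cos.
  - intros x _. apply continuity_pt_mult.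
    + apply (continuity_pt_comp K cosh).
      * apply (continuity_pt_comp (fun x => u ^ 2 + x ^ 2) sqrt).
        -- apply ex_derive_continuity_pt. auto_derive. exact I.
        -- apply continuity_pt_sqrt. nra.
      * apply ex_derive_continuity_pt. eexists. apply is_derive_Reals, derivable_pt_lim_cosh.
    + apply ex_derive_continuity_pt. auto_derive. exact I.
  - rewrite Rmin_left, Rmax_right in Hc by lra. rewrite cos_0 in Hm.
    assert (HK0 : K 0 = Rabs u).
    { unfold K. replace (u ^ 2 + 0 ^ 2) with (Rsqr u) by (unfold Rsqr; ring). apply sqrt_Rsqr_abs. }
    rewrite HK0, cosh_Rabs in Hm.
    assert (HPI := PI_RGT_0).
    assert (HKc : 0 <= K c) by apply sqrt_pos.
    assert (Hsin : c * cos c <= sin c) by (apply mult_cos_le_sin; lra).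
    assert (Hcos : 0 <= cos c) by (apply cos_ge_0; lra).
    assert (HD : sinh (K c) * (c / K c) * cos c <= cosh (K c) * sin c).
    { destruct (Rle_lt_or_eq_dec _ _ HKc) as [HK|HK].
      - apply Rle_trans with (cosh (K c) * (c * cos c)).
        + replace (sinh (K c) * (c / K c) * cos c) with (sinh (K c) / K c * (c * cos c)) by (field; lra).
          apply Rmult_le_compat_r; [apply Rmult_le_pos; lra|].
          apply Rmult_le_reg_r with (K c); [lra|].
          replace (sinh (K c) / K c * K c) with (sinh (K c)) by (field; lra).
          rewrite Rmult_comm. apply sinh_le_mult_cosh. lra.
        + apply Rmult_le_compat_l; [left; apply cosh_pos|exact Hsin].
      (* Here [K c = 0], and [sinh 0 = 0] cancels the quotient [c / K c] whatever it stands for. *)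
      - rewrite <- HK. unfold sinh at 1. rewrite Ropp_0, exp_0.
        assert (0 <= sin c) by (apply sin_ge_0; lra).
        assert (0 <= cosh 0 * sin c) by (apply Rmult_le_pos; [left; apply cosh_pos|lra]). lra. }
    assert ((sinh (K c) * (c / K c) * cos c - cosh (K c) * sin c) * (v - 0) <= 0) by nra.
    unfold K in *. lra.
Qed.

(** Otherwise [cosh k <= cosh (sqrt (u^2 + v^2))] by monotonicity, and the preceding estimate gives
    [cos v cosh k <= cosh u]. *)
Lemma cosh_lt_cos_mult_cosh u v k : 0 <= k -> Rabs v < PI / 2 ->
  cosh u < cos v * cosh k -> u ^ 2 + v ^ 2 < k ^ 2.
Proof.
  intros Hk Hv H. destruct (Rlt_le_dec (u ^ 2 + v ^ 2) (k ^ 2)) as [|Hle]; [assumption|exfalso].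
  assert (H1 := cosh_hypot_mult_cos_le u (Rabs v) ltac:(split; [apply Rabs_pos|exact Hv])).
  rewrite pow2_abs in H1.
  assert (Hc : cos (Rabs v) = cos v) by (unfold Rabs; destruct Rcase_abs; [apply cos_neg|reflexivity]).
  rewrite Hc in H1.
  assert (H2 : cosh k <= cosh (sqrt (u ^ 2 + v ^ 2))).
  { apply cosh_le. split; [exact Hk|]. rewrite <- (sqrt_pow2 k Hk). apply sqrt_le_1_alt, Hle. }
  assert (H3 : 0 <= cos v).
  { apply cos_ge_0; apply Rabs_def2 in Hv; lra. }
  nra.
Qed.

(** This is [|z - m|^2 < r^2] for the midpoint [m] and the half-length [r] of [[al, be]], expanded
    so that quotients and exponentials are handled by clearing positive factors. *)
Definition in_diameter_disk (al be : R) (z : C) : Prop :=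
  Cmod z ^ 2 - (al + be) * Re z + al * be < 0.

Lemma in_diameter_disk_Re al be z : al <= be -> in_diameter_disk al be z -> al < Re z < be.
Proof.
  unfold in_diameter_disk. rewrite Cmod2_alt. intros Hab H. split.
  - apply Rnot_le_lt. intros Hx. assert (H1 : (Re z - al) * (Re z - be) >= 0) by nra. nra.
  - apply Rnot_le_lt. intros Hx. assert (H1 : (Re z - al) * (Re z - be) >= 0) by nra. nra.
Qed.

(* With [log z = (ln al + ln be) / 2 + u + i v] and [k = (ln be - ln al) / 2] the
   disk condition reads [cosh u < cos v cosh k]. *)
Lemma Clog_diameter_disk al be z : 0 < al < be -> in_diameter_disk al be z ->
  Cmod (Clog z - RtoC ((ln al + ln be) / 2))%C < (ln be - ln al) / 2.
Proof.
  intros Hab Hz.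
  assert (Hre := in_diameter_disk_Re al be z ltac:(lra) Hz).
  assert (HE := Cexp_Clog z ltac:(lra)).
  set (m := (ln al + ln be) / 2). set (k := (ln be - ln al) / 2).
  assert (Hk : 0 < k).
  { unfold k. assert (ln al < ln be) by (apply ln_increasing; lra). lra. }
  set (u := Re (Clog z) - m). set (v := Im (Clog z)).
  assert (Hv : Rabs v < PI / 2).
  { unfold v, Clog. simpl. assert (HB := atan_bound (Im z / Re z)). apply Rabs_def1; lra. }
  assert (Hal : al = exp m * exp (- k)).
  { rewrite <- exp_plus. replace (m + - k) with (ln al) by (unfold m, k; field). symmetry. apply exp_ln; lra. }
  assert (Hbe : be = exp m * exp k).
  { rewrite <- exp_plus. replace (m + k) with (ln be) by (unfold m, k; field). symmetry. apply exp_ln; lra. }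
  assert (Hmod : Cmod z = exp m * exp u).
  { rewrite <- HE, Cmod_Cexp, <- exp_plus. f_equal. unfold u. ring. }
  assert (HR : Re z = exp m * exp u * cos v).
  { rewrite <- HE. unfold Cexp. simpl. rewrite <- exp_plus. f_equal. f_equal. unfold u. simpl. ring. }
  assert (Hkk : exp k * exp (- k) = 1) by (rewrite <- exp_plus, Rplus_opp_r; apply exp_0).
  assert (Huu : exp u * exp (- u) = 1) by (rewrite <- exp_plus, Rplus_opp_r; apply exp_0).
  assert (Hlt : cosh u < cos v * cosh k).
  { unfold in_diameter_disk in Hz. rewrite Hmod, HR, Hal, Hbe in Hz.
    assert (Hem := exp_pos m). assert (Heu := exp_pos u).
    apply Rmult_lt_reg_l with (2 * (exp m ^ 2 * exp u)).
    { apply Rmult_lt_0_compat; [lra|]. apply Rmult_lt_0_compat; [apply pow_lt; lra|lra]. }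
    unfold cosh.
    replace (2 * (exp m ^ 2 * exp u) * ((exp u + exp (- u)) / 2)) with
      (exp m ^ 2 * (exp u ^ 2 + exp u * exp (- u))) by field.
    replace (2 * (exp m ^ 2 * exp u) * (cos v * ((exp k + exp (- k)) / 2))) with
      (exp m ^ 2 * exp u * cos v * (exp k + exp (- k))) by field.
    rewrite Huu.
    replace (exp m * exp (- k) * (exp m * exp k)) with (exp m ^ 2) in Hz.
    - lra.
    - replace (exp m * exp (- k) * (exp m * exp k)) with (exp m ^ 2 * (exp k * exp (- k))) by ring.
      rewrite Hkk. ring. }
  assert (Hfin := cosh_lt_cos_mult_cosh u v k ltac:(lra) Hv Hlt).
  assert (HM := Cmod2_alt (Clog z - RtoC m)%C).
  replace (Re (Clog z - RtoC m)%C) with u in HM by reflexivity.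
  replace (Im (Clog z - RtoC m)%C) with v in HM by (unfold v; simpl; ring).
  rewrite <- HM in Hfin. assert (H0 := Cmod_ge_0 (Clog z - RtoC m)%C). nra.
Qed.

(** Moebius maps with real coefficients preserve the circles symmetric about the real axis.
    Concretely, once the denominators are cleared the form of the image is [s ^ 2], the squared
    determinant, times the original one. *)
Lemma in_diameter_disk_mobius s k a b p : 0 < s -> 0 < s + k * a -> 0 < s + k * b -> a <= b ->
  in_diameter_disk a b p ->
  in_diameter_disk (a / (s + k * a)) (b / (s + k * b)) (p / (s + k * p))%C.
Proof.
  intros Hs Ha Hb Hab Hp.
  assert (Hre := in_diameter_disk_Re a b p Hab Hp).
  unfold in_diameter_disk in *.
  set (d := (s + k * p)%C).
  assert (Hd : 0 < Re d).
  { unfold d. destruct p as [x y]. simpl in *. destruct (Rle_lt_dec 0 k); nra. }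
  assert (HD : Cmod d ^ 2 = s ^ 2 + 2 * s * k * Re p + k ^ 2 * Cmod p ^ 2).
  { rewrite !Cmod2_alt. unfold d. destruct p as [x y]. simpl. ring. }
  assert (Hd0 : 0 < Cmod d) by (eapply Rlt_le_trans; [exact Hd|]; eapply Rle_trans; [apply Rle_abs|apply re_le_Cmod]).
  assert (Hdn : d <> RtoC 0) by (apply Cmod_gt_0; exact Hd0).
  assert (HR : Re (p / d)%C = (s * Re p + k * Cmod p ^ 2) / Cmod d ^ 2).
  { rewrite !Cmod2_alt. unfold d, Cdiv, Cinv. destruct p as [x y]. simpl in *. field.
    assert (0 < (s + k * x) ^ 2) by (apply pow_lt; unfold d in Hd; simpl in Hd; lra).
    simpl in *. nra. }
  rewrite HR, Cmod_div by exact Hdn.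
  set (x := Re p) in *. set (P := Cmod p ^ 2) in *.
  replace ((Cmod p / Cmod d) ^ 2) with (P / Cmod d ^ 2) by (unfold P; field; lra).
  assert (HD0 : 0 < Cmod d ^ 2) by (apply pow_lt; exact Hd0).
  apply Rmult_lt_reg_r with (Cmod d ^ 2 * ((s + k * a) * (s + k * b))).
  { apply Rmult_lt_0_compat; [exact HD0|]. apply Rmult_lt_0_compat; assumption. }
  rewrite Rmult_0_l.
  set (D := Cmod d ^ 2) in *.
  match goal with |- ?e < 0 => replace e with (s ^ 2 * (P - (a + b) * x + a * b)) end.
  - assert (Hs2 : 0 < s ^ 2) by (apply pow_lt; lra). nra.
  - transitivity (P * ((s + k * a) * (s + k * b)) - (a * (s + k * b) + b * (s + k * a)) * (s * x + k * P) + a * b * D).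
    + rewrite HD. ring.
    + field. repeat split; lra.
Qed.

(** * The inverse of [frakB] on the disk with diameter [(b0, b1)] *)

Definition frakB_min : R := sqrt 2 / sqrt (1 + euler_e ^ 2).
Definition frakB_max : R := sqrt 2 * euler_e / sqrt (1 + euler_e ^ 2).

Lemma euler_e_gt_2 : 2 < euler_e.
Proof. unfold euler_e. assert (H := exp_ineq1 1 ltac:(lra)). lra. Qed.

Lemma frakB_max_min : frakB_max = euler_e * frakB_min.
Proof. unfold frakB_max, frakB_min, Rdiv. ring. Qed.

Lemma sqrt_1_plus_e2 : 0 < sqrt (1 + euler_e ^ 2) /\ sqrt (1 + euler_e ^ 2) ^ 2 = 1 + euler_e ^ 2.
Proof.
  assert (He := euler_e_gt_2). split; [apply sqrt_lt_R0; nra|].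
  rewrite pow2_sqrt; nra.
Qed.

Lemma frakB_min_sqr : frakB_min ^ 2 * (1 + euler_e ^ 2) = 2.
Proof.
  destruct sqrt_1_plus_e2 as [H1 H2]. unfold frakB_min.
  set (S := sqrt (1 + euler_e ^ 2)) in *. rewrite <- H2.
  replace ((sqrt 2 / S) ^ 2 * S ^ 2) with (sqrt 2 ^ 2) by (field; lra).
  apply pow2_sqrt. lra.
Qed.

Lemma frakB_min_pos : 0 < frakB_min.
Proof. apply Rdiv_lt_0_compat; [apply sqrt_lt_R0; lra|apply sqrt_1_plus_e2]. Qed.

(** The two numbers are the roots of [1 - tanh 1] and [1 + tanh 1]. The identity turns [2 - b^2] at
    either endpoint [b] into the square of the other. *)
Lemma frakB_min_max_sqr : frakB_min ^ 2 + frakB_max ^ 2 = 2.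
Proof. rewrite frakB_max_min, <- frakB_min_sqr. ring. Qed.

Lemma frakB_min_lt_1 : frakB_min < 1.
Proof.
  assert (H := frakB_min_sqr). assert (H0 := frakB_min_pos). assert (He := euler_e_gt_2).
  apply Rnot_le_lt. intros H1. assert (1 <= frakB_min ^ 2) by nra. nra.
Qed.

Lemma frakB_max_gt_1 : 1 < frakB_max.
Proof.
  assert (H := frakB_min_max_sqr). assert (H0 := frakB_min_pos). assert (H1 := frakB_min_lt_1).
  assert (0 < frakB_max).
  { rewrite frakB_max_min. assert (He := euler_e_gt_2). nra. }
  nra.
Qed.

Lemma frakB_max_lt_sqrt2 : frakB_max < sqrt 2.
Proof.
  assert (H := frakB_min_max_sqr). assert (H0 := frakB_min_pos). assert (H1 := frakB_max_gt_1).
  assert (H2 := pow2_sqrt 2 ltac:(lra)). assert (H3 := sqrt_pos 2). nra.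
Qed.

Lemma ln_frakB_max_min : ln frakB_max = 1 + ln frakB_min.
Proof.
  assert (He := euler_e_gt_2). rewrite frakB_max_min, ln_mult by (try apply frakB_min_pos; lra).
  unfold euler_e. rewrite ln_exp. reflexivity.
Qed.

(* [tanh w = p ^ 2 - 1] amounts to [exp (2 w) = p ^ 2 / (2 - p ^ 2)]. Splitting the
   right-hand side into two Moebius images of [p] keeps both logarithms on the
   right half-plane, and makes [|w| < 1] an addition of two disks. *)
Definition frakB_inv (p : C) : C :=
  (RtoC (/ 2) * (Clog (p / (RtoC (sqrt 2) + RtoC (-1) * p)) + Clog (p / (RtoC (sqrt 2) + RtoC 1 * p))))%C.

Lemma frakB_inv_parts p : in_diameter_disk frakB_min frakB_max p ->
  in_diameter_disk (frakB_min / (sqrt 2 + -1 * frakB_min)) (frakB_max / (sqrt 2 + -1 * frakB_max))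
    (p / (RtoC (sqrt 2) + RtoC (-1) * p))%C /\
  in_diameter_disk (frakB_min / (sqrt 2 + 1 * frakB_min)) (frakB_max / (sqrt 2 + 1 * frakB_max))
    (p / (RtoC (sqrt 2) + RtoC 1 * p))%C.
Proof.
  intros Hp. assert (H0 := frakB_min_pos). assert (H1 := frakB_max_gt_1).
  assert (H2 := frakB_max_lt_sqrt2). assert (H3 := frakB_min_lt_1).
  split; apply in_diameter_disk_mobius; lra || assumption.
Qed.

Lemma diameters_order :
  0 < frakB_min / (sqrt 2 + -1 * frakB_min) < frakB_max / (sqrt 2 + -1 * frakB_max) /\
  0 < frakB_min / (sqrt 2 + 1 * frakB_min) < frakB_max / (sqrt 2 + 1 * frakB_max).
Proof.
  assert (H0 := frakB_min_pos). assert (H1 := frakB_max_gt_1).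
  assert (H2 := frakB_max_lt_sqrt2). assert (H3 := frakB_min_lt_1).
  assert (F : forall k, 0 < sqrt 2 + k * frakB_min -> 0 < sqrt 2 + k * frakB_max ->
    0 < frakB_min / (sqrt 2 + k * frakB_min) < frakB_max / (sqrt 2 + k * frakB_max)).
  { intros k A B. split; [apply Rdiv_lt_0_compat; assumption|].
    apply Rmult_lt_reg_r with ((sqrt 2 + k * frakB_min) * (sqrt 2 + k * frakB_max)).
    - apply Rmult_lt_0_compat; assumption.
    - replace (frakB_min / (sqrt 2 + k * frakB_min) * ((sqrt 2 + k * frakB_min) * (sqrt 2 + k * frakB_max)))
        with (frakB_min * (sqrt 2 + k * frakB_max)) by (field; lra).
      replace (frakB_max / (sqrt 2 + k * frakB_max) * ((sqrt 2 + k * frakB_min) * (sqrt 2 + k * frakB_max)))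
        with (frakB_max * (sqrt 2 + k * frakB_min)) by (field; lra).
      nra. }
  split; apply F; lra.
Qed.

(** Since [(sqrt 2 - b1) (sqrt 2 + b1) = b0^2], and likewise with [b0] and [b1] exchanged, the
    centers [m1] and [m2] of the two logarithmic disks are opposite and their radii add up to
    [2 (ln b1 - ln b0) = 2]. The factor 1/2 in [frakB_inv] makes this 1. *)
Lemma frakB_inv_disk p : in_diameter_disk frakB_min frakB_max p -> Cmod (frakB_inv p) < 1.
Proof.
  intros Hp. destruct (frakB_inv_parts p Hp) as [D1 D2]. destruct diameters_order as [O1 O2].
  apply Clog_diameter_disk in D1; [|exact O1]. apply Clog_diameter_disk in D2; [|exact O2].
  unfold frakB_inv. set (L1 := Clog (p / (RtoC (sqrt 2) + RtoC (-1) * p))%C) in *.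
  set (L2 := Clog (p / (RtoC (sqrt 2) + RtoC 1 * p))%C) in *.
  assert (H0 := frakB_min_pos). assert (H1 := frakB_max_gt_1).
  assert (H2 := frakB_max_lt_sqrt2). assert (H3 := frakB_min_lt_1).
  rewrite !ln_div in D1, D2 by lra.
  assert (E : forall a b, 0 < a -> 0 < b -> b < sqrt 2 -> a ^ 2 + b ^ 2 = 2 ->
    ln (sqrt 2 + -1 * b) + ln (sqrt 2 + 1 * b) = 2 * ln a).
  { intros a b Ha Hb Hb2 Hab. rewrite <- ln_mult by lra.
    replace ((sqrt 2 + -1 * b) * (sqrt 2 + 1 * b)) with (a * a).
    - rewrite ln_mult; lra.
    - assert (H := pow2_sqrt 2 ltac:(lra)). nra. }
  assert (HS := frakB_min_max_sqr).
  assert (E1 := E frakB_max frakB_min ltac:(lra) ltac:(lra) ltac:(lra) ltac:(lra)).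
  assert (E2 := E frakB_min frakB_max ltac:(lra) ltac:(lra) ltac:(lra) ltac:(lra)).
  assert (E3 := ln_frakB_max_min).
  set (m1 := (ln frakB_min - ln (sqrt 2 + -1 * frakB_min) + (ln frakB_max - ln (sqrt 2 + -1 * frakB_max))) / 2) in *.
  set (m2 := (ln frakB_min - ln (sqrt 2 + 1 * frakB_min) + (ln frakB_max - ln (sqrt 2 + 1 * frakB_max))) / 2) in *.
  assert (Hm : m2 = - m1) by (unfold m1, m2; lra).
  replace (L1 + L2)%C with ((L1 - m1) + (L2 - m2))%C by (rewrite Hm, RtoC_opp; ring).
  rewrite Cmod_mult, Cmod_R, Rabs_pos_eq by lra.
  assert (HT := Cmod_triangle (L1 - m1) (L2 - m2)). lra.
Qed.

Lemma Csqrt_sqr p : 0 < Re p -> Csqrt (p * p)%C = p.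
Proof.
  destruct p as [x y]. simpl. intros Hx. unfold Csqrt.
  rewrite Cmod_mult. assert (HM := Cmod2_alt (x, y)). simpl Re in HM. simpl Im in HM.
  assert (E1 : (Cmod (x, y) * Cmod (x, y) + Re ((x, y) * (x, y))%C) / 2 = Rsqr x).
  { unfold Rsqr. simpl in *. lra. }
  assert (E2 : (Cmod (x, y) * Cmod (x, y) - Re ((x, y) * (x, y))%C) / 2 = Rsqr y).
  { unfold Rsqr. simpl in *. lra. }
  rewrite E1, E2, !sqrt_Rsqr_abs, (Rabs_pos_eq x) by lra.
  simpl. destruct Rle_dec as [H|H]; apply C_ext; simpl; try reflexivity.
  - apply Rabs_pos_eq. nra.
  - rewrite Rabs_left; nra.
Qed.

Lemma Csqrt_squared z : (Csqrt z * Csqrt z)%C = z.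
Proof.
  destruct z as [x y]. unfold Csqrt. simpl.
  assert (HM := Cmod2_alt (x, y)). simpl in HM.
  assert (H1 := re_le_Cmod (x, y)). simpl in H1. apply Rabs_le_between in H1.
  set (m := Cmod (x, y)) in *.
  assert (A := pow2_sqrt ((m + x) / 2) ltac:(lra)). assert (B := pow2_sqrt ((m - x) / 2) ltac:(lra)).
  assert (PP : sqrt ((m + x) / 2) * sqrt ((m - x) / 2) = Rabs y / 2).
  { rewrite <- sqrt_mult by lra. replace ((m + x) / 2 * ((m - x) / 2)) with (Rsqr (y / 2)).
    - rewrite sqrt_Rsqr_abs. unfold Rdiv. rewrite Rabs_mult, (Rabs_pos_eq (/ 2)); lra.
    - unfold Rsqr. nra. }
  destruct Rle_dec as [H|H]; apply C_ext; simpl.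
  - nra.
  - rewrite Rabs_pos_eq in PP by lra. lra.
  - nra.
  - rewrite Rabs_left in PP by lra. lra.
Qed.

(** With [E = exp W] one gets [E^2 (2 - p^2) = p^2], hence [1 + tanh W = 2 E^2 / (E^2 + 1) = p^2].
    As [p] lies in the right half-plane, the principal root returns [p] and not [- p]. *)
Lemma frakB_frakB_inv p : in_diameter_disk frakB_min frakB_max p -> frakB (frakB_inv p) = p.
Proof.
  intros Hp. destruct (frakB_inv_parts p Hp) as [D1 D2]. destruct diameters_order as [O1 O2].
  assert (H0 := frakB_min_pos). assert (H1 := frakB_max_gt_1).
  assert (H2 := frakB_max_lt_sqrt2). assert (H3 := frakB_min_lt_1).
  assert (R1 := in_diameter_disk_Re _ _ _ (Rlt_le _ _ (proj2 O1)) D1).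
  assert (R2 := in_diameter_disk_Re _ _ _ (Rlt_le _ _ (proj2 O2)) D2).
  assert (R0 := in_diameter_disk_Re frakB_min frakB_max p ltac:(lra) Hp).
  assert (N1 : (RtoC (sqrt 2) + RtoC (-1) * p)%C <> RtoC 0).
  { intros N. apply (f_equal Re) in N. simpl in N. destruct p as [x y]. simpl in *. lra. }
  assert (N2 : (RtoC (sqrt 2) + RtoC 1 * p)%C <> RtoC 0).
  { intros N. apply (f_equal Re) in N. simpl in N. destruct p as [x y]. simpl in *. lra. }
  set (W := frakB_inv p). set (E := Cexp W). set (E' := Cexp (- W)%C).
  assert (HEE : (E * E' = 1)%C) by apply Cexp_opp_r.
  assert (HE2 : (E * E * ((RtoC (sqrt 2) + RtoC (-1) * p) * (RtoC (sqrt 2) + RtoC 1 * p)) = p * p)%C).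
  { unfold E. rewrite <- Cexp_plus. unfold W, frakB_inv.
    match goal with |- (Cexp (?h * (?a + ?b) + _) * _ = _)%C =>
      replace (h * (a + b) + h * (a + b))%C with (a + b)%C end.
    - rewrite Cexp_plus, !Cexp_Clog by lra.
      set (d1 := (RtoC (sqrt 2) + RtoC (-1) * p)%C) in *.
      set (d2 := (RtoC (sqrt 2) + RtoC 1 * p)%C) in *. field. split; assumption.
    - apply C_ext; simpl; field. }
  assert (Hs2 : (RtoC (sqrt 2) * RtoC (sqrt 2) = 2)%C).
  { rewrite <- RtoC_mult, sqrt_sqrt by lra. reflexivity. }
  assert (HE3 : (E * E * (2 - p * p) = p * p)%C).
  { rewrite <- HE2 at 2. rewrite <- Hs2. ring. }
  (* In this form the equation also shows that [E^2 + 1], which is [E] times the denominator of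
     [tanh], does not vanish. *)
  assert (HE4 : ((E * E + 1) * (2 - p * p) = 2)%C).
  { replace ((E * E + 1) * (2 - p * p))%C with (E * E * (2 - p * p) + 2 - p * p)%C by ring.
    rewrite HE3. ring. }
  assert (NE1 : (E * E + 1)%C <> RtoC 0).
  { intros N. rewrite N, Cmult_0_l in HE4. apply RtoC_inj in HE4. lra. }
  assert (NE : E <> RtoC 0) by apply Cexp_neq_0.
  assert (HE' : E' = (/ E)%C).
  { replace E' with (/ E * (E * E'))%C by (field; exact NE). rewrite HEE. ring. }
  assert (HT : (1 + Ctanh W = p * p)%C).
  { unfold Ctanh. fold E. fold E'. rewrite HE'.
    transitivity (2 * (E * E) / (E * E + 1))%C; [field; split; assumption|].
    rewrite <- HE3. rewrite <- HE4 at 1. field. assumption. }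
  unfold frakB. rewrite HT. apply Csqrt_sqr. lra.
Qed.

Lemma ex_C_derive_frakB_inv p : in_diameter_disk frakB_min frakB_max p -> ex_C_derive frakB_inv p.
Proof.
  intros Hp. destruct (frakB_inv_parts p Hp) as [D1 D2]. destruct diameters_order as [O1 O2].
  assert (H0 := frakB_min_pos). assert (H1 := frakB_max_gt_1).
  assert (H2 := frakB_max_lt_sqrt2). assert (H3 := frakB_min_lt_1).
  assert (R1 := in_diameter_disk_Re _ _ _ (Rlt_le _ _ (proj2 O1)) D1).
  assert (R2 := in_diameter_disk_Re _ _ _ (Rlt_le _ _ (proj2 O2)) D2).
  assert (R0 := in_diameter_disk_Re frakB_min frakB_max p ltac:(lra) Hp).
  assert (N1 : (RtoC (sqrt 2) + RtoC (-1) * p)%C <> RtoC 0).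
  { intros N. apply (f_equal Re) in N. simpl in N. destruct p as [x y]. simpl in *. lra. }
  assert (N2 : (RtoC (sqrt 2) + RtoC 1 * p)%C <> RtoC 0).
  { intros N. apply (f_equal Re) in N. simpl in N. destruct p as [x y]. simpl in *. lra. }
  assert (HL : forall k : R, (RtoC (sqrt 2) + RtoC k * p)%C <> RtoC 0 ->
     0 < Re (p / (RtoC (sqrt 2) + RtoC k * p))%C ->
     ex_C_derive (fun p => Clog (p / (RtoC (sqrt 2) + RtoC k * p)))%C p).
  { intros k N HR. apply (ex_C_derive_comp Clog (fun p => p / (RtoC (sqrt 2) + RtoC k * p))%C).
    - eexists. apply is_derive_Clog. exact HR.
    - apply (ex_C_derive_mult (fun p => p)); [apply ex_C_derive_id|].
      apply (ex_C_derive_inv (fun p => RtoC (sqrt 2) + RtoC k * p)%C); [exact N|].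
      apply (ex_C_derive_plus (fun _ => RtoC (sqrt 2))); [apply ex_C_derive_const|].
      apply (ex_C_derive_mult (fun _ => RtoC k)); [apply ex_C_derive_const|apply ex_C_derive_id]. }
  unfold frakB_inv. apply (ex_C_derive_mult (fun _ => RtoC (/ 2))); [apply ex_C_derive_const|].
  apply (ex_C_derive_plus (fun p => Clog (p / (RtoC (sqrt 2) + RtoC (-1) * p))%C)); apply HL; lra || assumption.
Qed.

(** The two logarithms cancel because [(sqrt 2 - 1) (sqrt 2 + 1) = 1]. This makes the subordinating
    function vanish at 0. *)
Lemma frakB_inv_1 : frakB_inv (RtoC 1) = RtoC 0.
Proof.
  assert (H0 := pow2_sqrt 2 ltac:(lra)). assert (H1 := sqrt_pos 2).
  assert (H2 : 1 < sqrt 2) by nra.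
  assert (E : forall k : R, 0 < sqrt 2 + k -> Clog (1 / (RtoC (sqrt 2) + RtoC k * 1))%C = RtoC (- ln (sqrt 2 + k))).
  { intros k Hk. replace (1 / (RtoC (sqrt 2) + RtoC k * 1))%C with (RtoC (/ (sqrt 2 + k))).
    - unfold Clog. rewrite Cmod_R, Rabs_pos_eq by (left; apply Rinv_0_lt_compat; exact Hk).
      rewrite ln_Rinv by exact Hk. simpl. unfold Rdiv. rewrite Rmult_0_l, atan_0. reflexivity.
    - rewrite RtoC_inv, RtoC_plus by lra. unfold Cdiv. rewrite Cmult_1_r. ring. }
  unfold frakB_inv. rewrite !E by lra. rewrite <- RtoC_plus, <- RtoC_mult. f_equal.
  replace (- ln (sqrt 2 + -1) + - ln (sqrt 2 + 1)) with (- (ln (sqrt 2 + -1) + ln (sqrt 2 + 1))) by ring.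
  rewrite <- ln_mult by lra. replace ((sqrt 2 + -1) * (sqrt 2 + 1)) with 1 by nra.
  rewrite ln_1. ring.
Qed.

(** * Rescaling *)

Lemma Cmod_scal_lt (r : R) (z : C) : 0 < r <= 1 -> Cmod z < 1 -> Cmod (r * z)%C < r.
Proof.
  intros Hr Hz. rewrite Cmod_mult, Cmod_R, Rabs_pos_eq by lra. nra.
Qed.

Lemma class_S_rescale f r : 0 < r <= 1 -> class_S f -> class_S (fun z => f (RtoC r * z) / RtoC r)%C.
Proof.
  intros Hr [[Hf [a [H0 [H1 H]]]] Hu].
  assert (Hrn : RtoC r <> RtoC 0) by (intros N; apply RtoC_inj in N; lra).
  assert (Hin : forall z, Cmod z < 1 -> Cmod (r * z)%C < 1).
  { intros z Hz. assert (G := Cmod_scal_lt r z Hr Hz). lra. }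
  split; [split|].
  - intros z Hz. apply (ex_C_derive_mult (fun z => f (r * z)%C)); [|apply ex_C_derive_const].
    apply (ex_C_derive_comp f (fun z => r * z)%C); [apply Hf, Hin, Hz|].
    apply (ex_C_derive_mult (fun _ => RtoC r)); [apply ex_C_derive_const|apply ex_C_derive_id].
  - exists (fun n => / r * (a n * r ^ n))%C. split; [rewrite H0; ring|].
    split; [rewrite H1; simpl; field; exact Hrn|].
    intros z Hz. apply is_pseries_csum.
    replace (f (r * z) / r)%C with (/ r * f (r * z))%C by (unfold Cdiv; ring).
    apply csum_ext with (fun n => / r * (a n * (r * z) ^ n))%C.
    + intros n. rewrite Cpow_mult_l. ring.
    + apply csum_scal, is_pseries_csum, H, Hin, Hz.
  - intros z1 z2 Hz1 Hz2 E.
    assert (E1 : f (r * z1)%C = f (r * z2)%C).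
    { replace (f (r * z1)%C) with (f (r * z1) / r * r)%C by (field; exact Hrn).
      rewrite E. field. exact Hrn. }
    apply Hu in E1; [|apply Hin, Hz1|apply Hin, Hz2].
    replace z1 with (/ r * (r * z1))%C by (field; exact Hrn). rewrite E1. field. exact Hrn.
Qed.

Lemma class_S_neq_0 f z : class_S f -> Cmod z < 1 -> z <> RtoC 0 -> f z <> RtoC 0.
Proof.
  intros [Hf Hu] Hz Hz0 E. apply Hz0, Hu; [exact Hz|unfold unit_disk; rewrite Cmod_0; lra|].
  rewrite (class_A_0 f Hf). exact E.
Qed.

Lemma zf'_over_f_rescale f r z : 0 < r <= 1 -> class_S f -> Cmod z < 1 ->
  zf'_over_f (fun z => f (RtoC r * z) / RtoC r)%C z = zf'_over_f f (r * z)%C.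
Proof.
  intros Hr Hf Hz.
  assert (Hrn : RtoC r <> RtoC 0) by (intros N; apply RtoC_inj in N; lra).
  assert (Hin : Cmod (r * z)%C < 1) by (assert (G := Cmod_scal_lt r z Hr Hz); lra).
  unfold zf'_over_f. destruct (Ceq_dec z 0) as [->|Hz0].
  - destruct (Ceq_dec (r * 0)%C 0) as [_|N]; [reflexivity|]. exfalso; apply N; ring.
  - assert (Hrz : (r * z)%C <> RtoC 0) by (apply Cmult_neq_0; assumption).
    destruct (Ceq_dec (r * z)%C 0) as [N|_]; [contradiction|].
    assert (Hn := class_S_neq_0 f _ Hf Hin Hrz).
    destruct Hf as [[Hf _] _].
    assert (HD : is_C_derive f (r * z)%C (C_derive f (r * z)%C)).
    { apply C_derive_correct; [exact (RtoC 0)|apply Hf, Hin]. }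
    assert (HD2 : C_derive (fun z => f (r * z) / r)%C z = C_derive f (r * z)%C).
    { apply is_C_derive_unique.
      assert (HL := is_C_derive_mult (fun _ => RtoC r) (fun z => z) z _ _ (is_C_derive_const r z) (is_C_derive_id z)).
      assert (HC := is_C_derive_comp f (fun z => r * z)%C z _ _ HD HL).
      assert (HM := is_C_derive_mult (fun z => f (r * z)%C) (fun _ => / r)%C z _ _ HC (is_C_derive_const _ z)).
      replace (C_derive f (r * z)%C) with
        (C_derive f (r * z) * (0 * z + r * 1) * / r + f (r * z) * 0)%C by (field; exact Hrn).
      exact HM. }
    rewrite HD2. field. split; assumption.
Qed.

(** * Sufficiency of the two linear conditions *)

Lemma janowski_in_diameter_disk A B r w : -1 <= B -> B < A -> A <= 1 -> 0 < A -> 0 < r <= 1 ->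
  r * (A - frakB_max * B) <= frakB_max - 1 -> r * (A - frakB_min * B) <= 1 - frakB_min ->
  Cmod w < r ->
  in_diameter_disk frakB_min frakB_max ((1 + RtoC A * w) / (1 + RtoC B * w))%C.
Proof.
  intros HB HBA HA HA0 Hr C1 C2 Hw.
  assert (F0 := frakB_min_pos). assert (F1 := frakB_min_lt_1). assert (F2 := frakB_max_gt_1).
  assert (Hu := re_le_Cmod w). apply Rabs_le_between in Hu.
  set (b0 := frakB_min) in *. set (b1 := frakB_max) in *.
  set (s := Cmod w) in *. set (u := Re w) in *.
  assert (Hs0 : 0 <= s) by apply Cmod_ge_0.
  assert (HBw : 0 < Cmod (1 + B * w)%C).
  { eapply Rlt_le_trans; [|apply Cmod_sub_ge]. rewrite Cmod_1, Cmod_mult, Cmod_R.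
    assert (Rabs B <= 1) by (apply Rabs_le; lra). assert (H1 := Rabs_pos B). fold s. nra. }
  (* At a real point [x] the value [(1 + A x) / (1 + B x)] exceeds [b0] by [al + be x] and falls
     short of [b1] by [ga - de x], both over [1 + B x]. With [C1], [C2] and [B < A] these terms are
     positive at [x = s] and [x = - s]. *)
  set (al := 1 - b0). set (be := A - b0 * B). set (ga := b1 - 1). set (de := A - b1 * B).
  assert (Hbe : 0 < be) by (unfold be; destruct (Rle_lt_dec 0 B); nra).
  assert (P1 : 0 < al - be * s) by (unfold al, be in *; nra).
  assert (P2 : 0 < al + be * s) by (unfold al in *; nra).
  assert (P3 : 0 < ga - de * s) by (unfold ga, de in *; destruct (Rle_lt_dec (A - b1 * B) 0); nra).
  assert (P4 : 0 < ga + de * s).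
  { unfold ga, de. assert (0 < 1 - B * s) by nra. assert (0 <= (A - B) * s) by nra. nra. }
  (* The negated disk form with its denominator cleared. For fixed [s = |w|] it is affine in
     [u = Re w], hence a weighted mean of its values at [u = s] and [u = - s], where it factors into
     the positive terms above. *)
  assert (E : 0 < al * ga + (be * ga - al * de) * u - be * de * s ^ 2).
  { destruct (Rle_lt_or_eq_dec _ _ Hs0) as [Hs|Hs].
    - apply Rmult_lt_reg_l with (2 * s); [lra|]. rewrite Rmult_0_r.
      replace (2 * s * (al * ga + (be * ga - al * de) * u - be * de * s ^ 2)) with
        ((s + u) * ((al + be * s) * (ga - de * s)) + (s - u) * ((al - be * s) * (ga + de * s))) by ring.
      assert (Q1 : 0 < (al + be * s) * (ga - de * s)) by (apply Rmult_lt_0_compat; assumption).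
      assert (Q2 : 0 < (al - be * s) * (ga + de * s)) by (apply Rmult_lt_0_compat; assumption).
      destruct (Rle_lt_dec u 0); nra.
    - assert (u = 0) as -> by lra. rewrite <- Hs. unfold al, ga. nra. }
  unfold in_diameter_disk.
  assert (Hdn : (1 + B * w)%C <> RtoC 0) by (apply Cmod_gt_0; exact HBw).
  assert (HD0 : 0 < Cmod (1 + B * w)%C ^ 2) by (apply pow_lt; exact HBw).
  assert (HD : Cmod (1 + B * w)%C ^ 2 = 1 + 2 * B * u + B ^ 2 * s ^ 2).
  { unfold s, u. rewrite !Cmod2_alt. destruct w; simpl; ring. }
  assert (HN : Cmod (1 + A * w)%C ^ 2 = 1 + 2 * A * u + A ^ 2 * s ^ 2).
  { unfold s, u. rewrite !Cmod2_alt. destruct w; simpl; ring. }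
  assert (HR : Re ((1 + A * w) / (1 + B * w))%C = (1 + (A + B) * u + A * B * s ^ 2) / Cmod (1 + B * w)%C ^ 2).
  { assert (HX := HD0). unfold s, u. rewrite !Cmod2_alt in *. unfold Cdiv, Cinv. destruct w as [x y]. simpl in *. field.
    nra. }
  rewrite HR, Cmod_div by exact Hdn.
  replace ((Cmod (1 + A * w) / Cmod (1 + B * w)) ^ 2) with (Cmod (1 + A * w)%C ^ 2 / Cmod (1 + B * w)%C ^ 2) by (field; lra).
  rewrite HN. set (D := Cmod (1 + B * w)%C ^ 2) in *.
  apply Rmult_lt_reg_r with D; [exact HD0|]. rewrite Rmult_0_l.
  match goal with |- ?e < 0 =>
    replace e with (- (al * ga + (be * ga - al * de) * u - be * de * s ^ 2)); [lra|] end.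
  transitivity ((1 + 2 * A * u + A ^ 2 * s ^ 2) - (b0 + b1) * (1 + (A + B) * u + A * B * s ^ 2) + b0 * b1 * D).
  - rewrite HD. unfold al, be, ga, de. ring.
  - field. lra.
Qed.

Lemma janowski_rescaled_starlike A B r f : -1 <= B -> B < A -> A <= 1 -> 0 < A -> 0 < r <= 1 ->
  r * (A - frakB_max * B) <= frakB_max - 1 -> r * (A - frakB_min * B) <= 1 - frakB_min ->
  janowski A B f -> starlike_frakB (fun z => f (RtoC r * z) / RtoC r)%C.
Proof.
  intros HB HBA HA HA0 Hr C1 C2 [Hf [w [Hw1 [Hw2 [Hw0 Hsub]]]]].
  split; [apply class_S_rescale; assumption|].
  assert (HS := janowski_schwarz A B f w HB HBA HA Hf Hw2 Hsub Hw0).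
  set (p := fun z : C => ((1 + A * w (r * z)) / (1 + B * w (r * z)))%C).
  assert (Hin : forall z, Cmod z < 1 -> Cmod (r * z)%C < r) by (intros; apply Cmod_scal_lt; assumption).
  assert (Hp : forall z, Cmod z < 1 -> in_diameter_disk frakB_min frakB_max (p z)).
  { intros z Hz. specialize (Hin z Hz). apply janowski_in_diameter_disk with r; auto.
    eapply Rle_lt_trans; [apply HS; lra|exact Hin]. }
  exists (fun z => frakB_inv (p z)). split; [|split; [|split]].
  - intros z Hz. apply (ex_C_derive_comp frakB_inv p); [apply ex_C_derive_frakB_inv, Hp, Hz|].
    assert (Hrz : Cmod (r * z)%C < 1) by (specialize (Hin z Hz); lra).
    assert (Hwr : ex_C_derive (fun z => w (r * z)%C) z).
    { apply (ex_C_derive_comp w (fun z => r * z)%C); [apply Hw1, Hrz|].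
      apply (ex_C_derive_mult (fun _ => RtoC r)); [apply ex_C_derive_const|apply ex_C_derive_id]. }
    assert (HL : forall k : R, ex_C_derive (fun z => 1 + k * w (r * z))%C z).
    { intros k. apply (ex_C_derive_plus (fun _ => RtoC 1)); [apply ex_C_derive_const|].
      apply (ex_C_derive_mult (fun _ => RtoC k)); [apply ex_C_derive_const|exact Hwr]. }
    apply (ex_C_derive_mult (fun z => 1 + A * w (r * z))%C); [apply HL|].
    apply (ex_C_derive_inv (fun z => 1 + B * w (r * z))%C); [|apply HL].
    apply Cmod_gt_0. eapply Rlt_le_trans; [|apply Cmod_sub_ge]. rewrite Cmod_1, Cmod_mult, Cmod_R.
    assert (Rabs B <= 1) by (apply Rabs_le; lra). assert (H1 := Rabs_pos B).
    assert (H2 := Hw2 _ Hrz). unfold unit_disk in H2. assert (H3 := Cmod_ge_0 (w (r * z)%C)). nra.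
  - intros z Hz. apply frakB_inv_disk, Hp, Hz.
  - unfold p. rewrite Cmult_0_r, Hw0, !Cmult_0_r.
    replace ((1 + 0) / (1 + 0))%C with (RtoC 1); [apply frakB_inv_1|].
    apply C_ext; simpl; field.
  - intros z Hz. rewrite zf'_over_f_rescale by assumption.
    rewrite frakB_frakB_inv by (apply Hp, Hz). apply Hsub.
    unfold unit_disk. specialize (Hin z Hz). lra.
Qed.

(** * The extremal function *)

Lemma is_derive_line (g : C -> C) (k z d l : C) (t0 : R) : is_C_derive g (z + t0 * d)%C l ->
  is_derive (K := R_AbsRing) (V := R_NormedModule) (fun t : R => Re (k * g (z + t * d))%C) t0 (Re (k * l * d)%C).
Proof.
  rewrite is_derive_C_eps. intros H.
  apply is_derive_Reals. intros eps Heps.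
  set (M := Cmod k * Cmod d + 1).
  assert (HM : 0 < M).
  { unfold M. assert (0 <= Cmod k * Cmod d) by (apply Rmult_le_pos; apply Cmod_ge_0). lra. }
  destruct (H (eps / (2 * M))) as [e [He HH]]; [apply Rdiv_lt_0_compat; lra|].
  assert (Hd : 0 < Cmod d + 1) by (assert (G := Cmod_ge_0 d); lra).
  assert (Hed : 0 < e / (Cmod d + 1)) by (apply Rdiv_lt_0_compat; lra).
  exists (mkposreal _ Hed). intros h Hh0 Hh. simpl in Hh.
  assert (Hah : 0 < Rabs h) by (apply Rabs_pos_lt; exact Hh0).
  assert (Hhd : Cmod (RtoC h * d)%C < e).
  { rewrite Cmod_mult, Cmod_R. apply Rlt_le_trans with (e / (Cmod d + 1) * (Cmod d + 1)).
    - apply Rle_lt_trans with (Rabs h * (Cmod d + 1)); [nra|]. apply Rmult_lt_compat_r; lra.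
    - apply Req_le. field. lra. }
  specialize (HH _ Hhd).
  set (q := (g (z + t0 * d + h * d) - g (z + t0 * d) - l * (h * d))%C) in *.
  replace ((Re (k * g (z + RtoC (t0 + h)%R * d))%C - Re (k * g (z + t0 * d))%C) / h - Re (k * l * d)%C)
    with (Re (k * q)%C / h).
  - unfold Rdiv. rewrite Rabs_mult, Rabs_inv.
    apply Rmult_lt_reg_r with (Rabs h); [exact Hah|]. rewrite Rmult_assoc, Rinv_l, Rmult_1_r by lra.
    eapply Rle_lt_trans; [apply re_le_Cmod|]. rewrite Cmod_mult.
    rewrite (Cmod_mult (RtoC h) d), Cmod_R in HH.
    apply Rle_lt_trans with (Cmod k * (eps / (2 * M) * (Rabs h * Cmod d))).
    + apply Rmult_le_compat_l; [apply Cmod_ge_0|exact HH].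
    + replace (Cmod k * (eps / (2 * M) * (Rabs h * Cmod d))) with
        (eps * Rabs h * (Cmod k * Cmod d / (2 * M))) by (field; lra).
      assert (Cmod k * Cmod d / (2 * M) < 1).
      { apply Rmult_lt_reg_r with (2 * M); [lra|]. unfold Rdiv. rewrite Rmult_assoc, Rinv_l by lra.
        assert (0 <= Cmod k * Cmod d) by (apply Rmult_le_pos; apply Cmod_ge_0).
        unfold M in *. lra. }
      assert (0 < eps * Rabs h) by (apply Rmult_lt_0_compat; lra). nra.
  - unfold q. replace (z + t0 * d + h * d)%C with (z + RtoC (t0 + h)%R * d)%C by (rewrite RtoC_plus; ring).
    set (g1 := g (z + RtoC (t0 + h)%R * d)%C). set (g0 := g (z + t0 * d)%C).
    destruct k, g1, g0, l, d. simpl. field. exact Hh0.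
Qed.

(** The mean value theorem fails for complex values, so it is applied to [Re (k g)] with a free
    multiplier: [k = 1] and [k = Ci] recover both coordinates, and [k] conjugate to [d] produces
    [|d|^2 Re g']. *)
Lemma line_mean_value (g g' : C -> C) (k z d : C) :
  (forall t, 0 <= t <= 1 -> is_C_derive g (z + RtoC t * d)%C (g' (z + RtoC t * d)%C)) ->
  exists t, 0 <= t <= 1 /\
    Re (k * g (z + d))%C - Re (k * g z)%C = Re (k * g' (z + RtoC t * d) * d)%C.
Proof.
  intros H.
  destruct (MVT_gen (fun t : R => Re (k * g (z + t * d))%C) 0 1 (fun t => Re (k * g' (z + RtoC t * d) * d)%C))
    as [c [Hc E]].
  - intros x Hx. rewrite Rmin_left, Rmax_right in Hx by lra. apply is_derive_line, H. lra.
  - intros x Hx. rewrite Rmin_left, Rmax_right in Hx by lra.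
    apply ex_derive_continuity_pt. eexists. apply is_derive_line, H. lra.
  - rewrite Rmin_left, Rmax_right in Hc by lra. exists c. split; [exact Hc|].
    replace (z + RtoC 1 * d)%C with (z + d)%C in E by ring.
    replace (z + RtoC 0 * d)%C with z in E by ring. rewrite E. ring.
Qed.

Lemma Cmod_scal_le (t : R) (z : C) : 0 <= t <= 1 -> Cmod (t * z)%C <= Cmod z.
Proof.
  intros Ht. rewrite Cmod_mult, Cmod_R, Rabs_pos_eq by lra. assert (H := Cmod_ge_0 z). nra.
Qed.

Lemma constant_on_disk (g : C -> C) :
  (forall z, Cmod z < 1 -> is_C_derive g z (RtoC 0)) ->
  forall z, Cmod z < 1 -> g z = g (RtoC 0).
Proof.
  intros H z Hz.
  assert (HM : forall k, Re (k * g z)%C = Re (k * g 0)%C).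
  { intros k. destruct (line_mean_value g (fun _ => RtoC 0) k 0 z) as [t [_ E]].
    - intros t Ht. apply H. replace (0 + t * z)%C with (t * z)%C by ring.
      eapply Rle_lt_trans; [apply Cmod_scal_le, Ht|exact Hz].
    - replace (0 + z)%C with z in E by ring.
      replace (k * 0 * z)%C with (RtoC 0) in E by ring. simpl in E. simpl. lra. }
  apply C_ext.
  - assert (E := HM (RtoC 1)). rewrite !Cmult_1_l in E. exact E.
  - assert (E := HM Ci). destruct (g z), (g (RtoC 0)). simpl in *. lra.
Qed.

Lemma disk_coeffs_of_bound (a : nat -> C) M : (forall n, Cmod (a n) <= M) -> disk_coeffs a.
Proof.
  intros H rho Hr. exists M. intros n.
  assert (H1 : rho ^ n <= 1) by (rewrite <- (pow1 n); apply pow_incr; lra).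
  assert (H2 : 0 <= rho ^ n) by (apply pow_le; lra).
  assert (H3 := Cmod_ge_0 (a n)). specialize (H n). nra.
Qed.

(** The numbers [n + 1] are the derived coefficients of the geometric series. *)
Lemma disk_coeffs_of_linear_bound (a : nat -> C) : (forall n, Cmod (a n) <= INR (S n)) -> disk_coeffs a.
Proof.
  intros H rho Hr.
  destruct (disk_coeffs_derive (fun _ => RtoC 1) (disk_coeffs_of_bound (fun _ => RtoC 1) 1 ltac:(intros; cbv beta; rewrite Cmod_1; lra)) rho Hr)
    as [M HM].
  exists M. intros n. eapply Rle_trans; [|apply (HM n)].
  apply Rmult_le_compat_r; [apply pow_le; lra|].
  unfold dcoeffs. rewrite Cmult_1_r, Cmod_R, Rabs_pos_eq by apply pos_INR. apply H.
Qed.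

Lemma psum_linear (u v : C) (a b : nat -> C) z : disk_coeffs a -> disk_coeffs b -> Cmod z < 1 ->
  psum (fun n => u * a n + v * b n)%C z = (u * psum a z + v * psum b z)%C.
Proof.
  intros Ha Hb Hz. apply csum_cseries.
  apply csum_ext with (fun n => u * (a n * z ^ n) + v * (b n * z ^ n))%C; [intros; ring|].
  apply csum_plus; apply csum_scal, psum_csum; assumption.
Qed.

Lemma psum_ext a b z : (forall n, a n = b n) -> psum a z = psum b z.
Proof.
  intros H. unfold psum, cseries. f_equal; apply Series_ext; intros n; rewrite H; reflexivity.
Qed.

(** Binomial series of [(1 + B z) ^ ((A - B) / B)], or of [exp (A z)] when [B = 0]; the recurrence
    covers both without dividing by [B]. It is [f z / z] for the extremal [f]. *)
Fixpoint extremal_coeffs (A B : R) (n : nat) : R :=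
  match n with
  | O => 1
  | S n => extremal_coeffs A B n * (A - B * INR (S n)) / INR (S n)
  end.

(** Series of [(A - B) / B * ln (1 + B z)], or of [A z] when [B = 0]: the logarithm of the binomial
    series. *)
Definition log_extremal_coeffs (A B : R) (n : nat) : R :=
  match n with O => 0 | S n => (A - B) * (- B) ^ n / INR (S n) end.

Definition extremal_factor (A B : R) : C -> C := psum (fun n => RtoC (extremal_coeffs A B n)).
Definition log_extremal (A B : R) : C -> C := psum (fun n => RtoC (log_extremal_coeffs A B n)).

Lemma extremal_disk_coeffs A B : -1 <= B -> B < A -> A <= 1 ->
  disk_coeffs (fun n => RtoC (extremal_coeffs A B n)).
Proof.
  intros HB HBA HA. apply disk_coeffs_of_linear_bound. intros n. rewrite Cmod_R.
  induction n.
  - simpl. rewrite Rabs_pos_eq; lra.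
  - change (extremal_coeffs A B (S n)) with (extremal_coeffs A B n * (A - B * INR (S n)) / INR (S n)).
    assert (Hn : 0 < INR (S n)) by (apply lt_0_INR; lia).
    unfold Rdiv. rewrite !Rabs_mult, (Rabs_pos_eq (/ INR (S n))) by (left; apply Rinv_0_lt_compat, Hn).
    (* Each step multiplies the modulus by at most [(n + 2) / (n + 1)], so the bound [n + 1]
       propagates. It is attained for [A = 1], [B = -1], the Koebe function. *)
    assert (H1 : Rabs (A - B * INR (S n)) <= 1 + INR (S n)) by (apply Rabs_le; nra).
    rewrite (S_INR (S n)). apply Rmult_le_reg_r with (INR (S n)); [exact Hn|].
    rewrite Rmult_assoc, Rinv_l, Rmult_1_r by lra.
    replace ((INR (S n) + 1) * INR (S n)) with (INR (S n) * (1 + INR (S n))) by ring.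
    apply Rmult_le_compat; auto using Rabs_pos.
Qed.

Lemma log_extremal_disk_coeffs A B : -1 <= B -> B < A -> A <= 1 ->
  disk_coeffs (fun n => RtoC (log_extremal_coeffs A B n)).
Proof.
  intros HB HBA HA. apply disk_coeffs_of_bound with 2. intros n. rewrite Cmod_R.
  destruct n; simpl log_extremal_coeffs; [rewrite Rabs_R0; lra|].
  assert (Hn : 1 <= INR (S n)) by (rewrite S_INR; assert (H := pos_INR n); lra).
  change (match n with O => 1 | S _ => INR n + 1 end) with (INR (S n)).
  unfold Rdiv. rewrite !Rabs_mult, <- RPow_abs.
  assert (H1 : Rabs (A - B) <= 2) by (apply Rabs_le; lra).
  assert (H2 : 0 <= Rabs (- B) ^ n <= 1).
  { split; [apply pow_le, Rabs_pos|]. rewrite <- (pow1 n). apply pow_incr.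
    split; [apply Rabs_pos|apply Rabs_le; lra]. }
  assert (H3 : 0 < / INR (S n) <= 1).
  { split; [apply Rinv_0_lt_compat; lra|]. rewrite <- Rinv_1. apply Rinv_le_contravar; lra. }
  rewrite (Rabs_pos_eq (/ INR (S n))) by lra.
  assert (H4 := Rabs_pos (A - B)).
  assert (H5 : 0 <= Rabs (A - B) * Rabs (- B) ^ n <= 2) by nra. nra.
Qed.

Lemma is_C_derive_psum a z : disk_coeffs a -> Cmod z < 1 -> is_C_derive (psum a) z (psum (dcoeffs a) z).
Proof. intros Ha Hz. destruct (psum_expands a z Ha Hz) as [c H]. eapply expands2_derive, H. Qed.

Lemma log_extremal_ode A B z : -1 <= B -> B < A -> A <= 1 -> Cmod z < 1 ->
  ((1 + B * z) * psum (dcoeffs (fun n => RtoC (log_extremal_coeffs A B n))) z = A - B)%C.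
Proof.
  intros HB HBA HA Hz. set (d := dcoeffs _).
  assert (Hd : disk_coeffs d) by (apply disk_coeffs_derive, log_extremal_disk_coeffs; assumption).
  assert (Ed : forall n, d n = RtoC ((A - B) * (- B) ^ n)).
  { intros n. unfold d, dcoeffs. rewrite <- RtoC_mult. f_equal.
    simpl log_extremal_coeffs. change (match n with O => 1 | S _ => INR n + 1 end) with (INR (S n)).
    field. apply not_0_INR. lia. }
  assert (E := psum_shift d z Hd (disk_coeffs_shift d Hd) Hz).
  rewrite (psum_ext (fun n => d (S n)) (fun n => - B * d n + 0 * d n)%C) in E.
  - rewrite psum_linear in E by assumption.
    replace ((1 + B * z) * psum d z)%C with (psum d z + B * z * psum d z)%C by ring.
    rewrite E at 1. rewrite Ed. simpl pow. rewrite Rmult_1_r, RtoC_minus. ring.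
  - intros n. rewrite !Ed. rewrite <- RtoC_opp, <- !RtoC_mult, <- RtoC_plus. f_equal. simpl. ring.
Qed.

Lemma extremal_ode A B z : -1 <= B -> B < A -> A <= 1 -> Cmod z < 1 ->
  ((1 + B * z) * psum (dcoeffs (fun n => RtoC (extremal_coeffs A B n))) z
    = (A - B) * extremal_factor A B z)%C.
Proof.
  intros HB HBA HA Hz. unfold extremal_factor. set (c := fun n => RtoC (extremal_coeffs A B n)).
  assert (Hc : disk_coeffs c) by (apply extremal_disk_coeffs; assumption).
  assert (Hd := disk_coeffs_derive c Hc).
  (* The coefficients of [z F']; the recurrence reads [(n + 1) c (n + 1) = (A - B) c n - B e n]. *)
  set (e := fun n => (INR n * c n)%C).
  assert (He : disk_coeffs e).
  { intros rho Hr. destruct (Hd rho Hr) as [M HM]. exists (Rmax 0 (M * rho)). intros n. destruct n.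
    - unfold e. simpl. rewrite Cmult_0_l, Cmod_0, Rmult_0_l. apply Rmax_l.
    - eapply Rle_trans; [|apply Rmax_r]. specialize (HM n).
      change (e (S n)) with (dcoeffs c n). simpl pow.
      replace (Cmod (dcoeffs c n) * (rho * rho ^ n)) with (Cmod (dcoeffs c n) * rho ^ n * rho) by ring.
      apply Rmult_le_compat_r; lra. }
  assert (E1 := psum_shift e z He Hd Hz).
  assert (E2 : psum (dcoeffs c) z = psum (fun n => (A - B) * c n + - B * e n)%C z).
  { apply psum_ext. intros n. unfold dcoeffs, e, c.
    rewrite <- RtoC_minus, <- RtoC_opp, <- !RtoC_mult, <- RtoC_plus. f_equal.
    change (extremal_coeffs A B (S n)) with (extremal_coeffs A B n * (A - B * INR (S n)) / INR (S n)).
    rewrite S_INR. field. assert (H := pos_INR n). lra. }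
  rewrite psum_linear in E2 by assumption.
  replace ((1 + B * z) * psum (dcoeffs c) z)%C with (psum (dcoeffs c) z + B * (z * psum (dcoeffs c) z))%C by ring.
  rewrite E2 at 1. rewrite E1. unfold e at 1. simpl INR.
  change (fun n => e (S n)) with (dcoeffs c). ring.
Qed.

Lemma one_plus_mult_neq_0 (B : R) (z : C) : -1 <= B <= 1 -> Cmod z < 1 -> (1 + B * z)%C <> RtoC 0.
Proof.
  intros HB Hz. apply Cmod_gt_0. eapply Rlt_le_trans; [|apply Cmod_sub_ge].
  rewrite Cmod_1, Cmod_mult, Cmod_R.
  assert (Rabs B <= 1) by (apply Rabs_le; lra). assert (H1 := Rabs_pos B).
  assert (H2 := Cmod_ge_0 z). nra.
Qed.

Lemma is_C_derive_log_extremal A B z : -1 <= B -> B < A -> A <= 1 -> Cmod z < 1 ->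
  is_C_derive (log_extremal A B) z ((A - B) / (1 + B * z))%C.
Proof.
  intros HB HBA HA Hz. assert (Hn := one_plus_mult_neq_0 B z ltac:(lra) Hz).
  assert (H := is_C_derive_psum _ z (log_extremal_disk_coeffs A B HB HBA HA) Hz).
  rewrite <- (log_extremal_ode A B z HB HBA HA Hz).
  replace ((1 + B * z) * psum (dcoeffs (fun n => RtoC (log_extremal_coeffs A B n))) z / (1 + B * z))%C
    with (psum (dcoeffs (fun n => RtoC (log_extremal_coeffs A B n))) z) by (field; exact Hn).
  exact H.
Qed.

Lemma is_C_derive_extremal_factor A B z : -1 <= B -> B < A -> A <= 1 -> Cmod z < 1 ->
  is_C_derive (extremal_factor A B) z ((A - B) / (1 + B * z) * extremal_factor A B z)%C.
Proof.
  intros HB HBA HA Hz. assert (Hn := one_plus_mult_neq_0 B z ltac:(lra) Hz).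
  assert (H := is_C_derive_psum _ z (extremal_disk_coeffs A B HB HBA HA) Hz).
  replace ((A - B) / (1 + B * z) * extremal_factor A B z)%C
    with ((A - B) * extremal_factor A B z / (1 + B * z))%C by (field; exact Hn).
  rewrite <- (extremal_ode A B z HB HBA HA Hz).
  replace ((1 + B * z) * psum (dcoeffs (fun n => RtoC (extremal_coeffs A B n))) z / (1 + B * z))%C
    with (psum (dcoeffs (fun n => RtoC (extremal_coeffs A B n))) z) by (field; exact Hn).
  exact H.
Qed.

(** The quotient of both sides has derivative 0 and value 1 at the origin. The exponential form
    excludes zeros and provides the logarithmic coordinate used for univalence. *)
Lemma extremal_factor_Cexp A B z : -1 <= B -> B < A -> A <= 1 -> Cmod z < 1 ->
  extremal_factor A B z = Cexp (log_extremal A B z).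
Proof.
  intros HB HBA HA Hz.
  assert (H : (extremal_factor A B z * Cexp (- log_extremal A B z) = 1)%C).
  { rewrite (constant_on_disk (fun z => extremal_factor A B z * Cexp (- log_extremal A B z))%C); [| |exact Hz].
    - unfold extremal_factor, log_extremal. rewrite !psum_0. simpl.
      replace (- 0)%C with (RtoC 0) by ring. rewrite Cexp_0. ring.
    - intros y Hy.
      assert (H1 := is_C_derive_extremal_factor A B y HB HBA HA Hy).
      assert (H2 := is_C_derive_log_extremal A B y HB HBA HA Hy).
      assert (H3 := is_C_derive_mult _ _ _ _ _ (is_C_derive_const (RtoC (-1)) y) H2). cbv beta in H3.
      assert (H4 := is_C_derive_comp Cexp (fun y => RtoC (-1) * log_extremal A B y)%C y _ _ (is_derive_Cexp _) H3).
      assert (H5 := is_C_derive_mult _ _ _ _ _ H1 H4). cbv beta in H5.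
      apply is_derive_ext_disk with (fun y => extremal_factor A B y * Cexp (RtoC (-1) * log_extremal A B y))%C;
        [exact Hy| |].
      + intros v _. f_equal. f_equal. ring.
      + match type of H5 with is_derive _ _ ?l => replace (RtoC 0) with l by ring end.
        exact H5. }
  rewrite <- (Cmult_1_r (extremal_factor A B z)), <- (Cexp_opp_r (log_extremal A B z)).
  transitivity (extremal_factor A B z * Cexp (- log_extremal A B z) * Cexp (log_extremal A B z))%C; [ring|].
  rewrite H. ring.
Qed.

(** [Clog] inverts [Cexp] on the right half-plane only; at most three quarter turns bring any
    nonzero number there. *)
Lemma Cexp_surj (z : C) : z <> RtoC 0 -> exists x, Cexp x = z.
Proof.
  intros Hz.
  assert (HPI2 : Cexp (0, PI / 2) = Ci).
  { unfold Cexp. simpl. rewrite exp_0, cos_PI2, sin_PI2. apply C_ext; simpl; ring. }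
  assert (Hrot : forall u, (exists x, Cexp x = (- (Ci * u))%C) -> exists x, Cexp x = u).
  { intros u [x Hx]. exists (x + (0, PI / 2)%R)%C. rewrite Cexp_plus, Hx, HPI2.
    apply C_ext; destruct u; simpl; ring. }
  assert (Hpos : forall u, 0 < Re u -> exists x, Cexp x = u).
  { intros u Hu. exists (Clog u). apply Cexp_Clog, Hu. }
  destruct z as [x y].
  destruct (Rtotal_order 0 x) as [H|[H|H]]; [apply Hpos; exact H| |].
  - destruct (Rtotal_order 0 y) as [H'|[H'|H']].
    + apply Hrot, Hpos. simpl. lra.
    + exfalso. apply Hz. subst. reflexivity.
    + apply Hrot, Hrot, Hrot, Hpos. simpl. lra.
  - apply Hrot, Hrot, Hpos. simpl. lra.
Qed.

Lemma Re_janowski_pos A B z : -1 <= B -> B < A -> A <= 1 -> Cmod z < 1 ->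
  0 < Re ((1 + A * z) / (1 + B * z))%C.
Proof.
  intros HB HBA HA Hz. assert (Hn := one_plus_mult_neq_0 B z ltac:(lra) Hz).
  apply Cmod_gt_0 in Hn.
  assert (HD : 0 < Cmod (1 + B * z)%C ^ 2) by (apply pow_lt, Hn).
  assert (Hu := re_le_Cmod z). apply Rabs_le_between in Hu. assert (Hs0 := Cmod_ge_0 z).
  assert (HR : Re ((1 + A * z) / (1 + B * z))%C
    = (1 + (A + B) * Re z + A * B * Cmod z ^ 2) / Cmod (1 + B * z)%C ^ 2).
  { assert (HX := HD). rewrite !Cmod2_alt in *. unfold Cdiv, Cinv. destruct z as [x y]. simpl in *. field.
    nra. }
  rewrite HR. apply Rdiv_lt_0_compat; [|exact HD].
  set (s := Cmod z) in *. set (u := Re z) in *.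
  assert (P : forall k, -1 <= k <= 1 -> 0 < 1 + k * s /\ 0 < 1 - k * s) by (intros; split; nra).
  destruct (P A ltac:(lra)) as [A1 A2]. destruct (P B ltac:(lra)) as [B1 B2].
  destruct (Rle_lt_or_eq_dec _ _ Hs0) as [Hs|Hs].
  - apply Rmult_lt_reg_l with (2 * s); [lra|]. rewrite Rmult_0_r.
    (* As for the disk condition, an affine function of [u] is a weighted mean of its values at
       [u = s] and [u = - s], where it factors. *)
    replace (2 * s * (1 + (A + B) * u + A * B * s ^ 2)) with
      ((s + u) * ((1 + A * s) * (1 + B * s)) + (s - u) * ((1 - A * s) * (1 - B * s))) by ring.
    assert (Q1 : 0 < (1 + A * s) * (1 + B * s)) by (apply Rmult_lt_0_compat; assumption).
    assert (Q2 : 0 < (1 - A * s) * (1 - B * s)) by (apply Rmult_lt_0_compat; assumption).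
    destruct (Rle_lt_dec u 0); nra.
  - assert (u = 0) as -> by lra. rewrite <- Hs. lra.
Qed.

Definition extremal (A B : R) (z : C) : C := (z * extremal_factor A B z)%C.

(* In the logarithmic coordinate [z = exp x] the function becomes
   [x + log_extremal (exp x)] on the convex half-plane [Re x < 0], with derivative
   of positive real part. *)
Lemma extremal_univalent A B : -1 <= B -> B < A -> A <= 1 -> univalent_on_disk (extremal A B).
Proof.
  intros HB HBA HA z1 z2 Hz1 Hz2 E. unfold unit_disk, extremal in *.
  assert (HE1 := extremal_factor_Cexp A B z1 HB HBA HA Hz1).
  assert (HE2 := extremal_factor_Cexp A B z2 HB HBA HA Hz2).
  assert (N1 : extremal_factor A B z1 <> RtoC 0) by (rewrite HE1; apply Cexp_neq_0).
  assert (N2 : extremal_factor A B z2 <> RtoC 0) by (rewrite HE2; apply Cexp_neq_0).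
  assert (H21 : z2 = (z1 * extremal_factor A B z1 / extremal_factor A B z2)%C).
  { rewrite E. field. exact N2. }
  destruct (Ceq_dec z1 0) as [H10|H10].
  { rewrite H21, H10. unfold Cdiv. ring. }
  destruct (Cexp_surj z1 H10) as [x1 Hx1].
  (* Among the logarithms of [z2] this is the one with [psi x2 = psi x1], so no multiple of [2 PI i]
     has to be discussed. *)
  set (x2 := (x1 + log_extremal A B z1 - log_extremal A B z2)%C).
  assert (Hx2 : Cexp x2 = z2).
  { rewrite H21, HE1, HE2. unfold x2, Cminus. rewrite !Cexp_plus, Hx1.
    assert (HO := Cexp_opp_r (log_extremal A B z2)).
    assert (HN := Cexp_neq_0 (log_extremal A B z2)).
    replace (Cexp (- log_extremal A B z2)) with
      (/ Cexp (log_extremal A B z2) * (Cexp (log_extremal A B z2) * Cexp (- log_extremal A B z2)))%C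
      by (field; exact HN).
    rewrite HO. field. exact HN. }
  set (psi := fun x => (x + log_extremal A B (Cexp x))%C).
  assert (Hneg : forall x, Cmod (Cexp x) < 1 <-> Re x < 0).
  { intros x. rewrite Cmod_Cexp, <- exp_0. split; [apply exp_lt_inv|apply exp_increasing]. }
  assert (R1 : Re x1 < 0) by (apply Hneg; rewrite Hx1; exact Hz1).
  assert (R2 : Re x2 < 0) by (apply Hneg; rewrite Hx2; exact Hz2).
  set (d := (x1 - x2)%C).
  (* The multiplier conjugate to [d] makes the right side [|d|^2 Re p] with [Re p > 0], while the
     left side is 0; so [d = 0]. *)
  destruct (line_mean_value psi (fun x => (1 + A * Cexp x) / (1 + B * Cexp x))%C (Cconj d) x2 d)
    as [t [Ht Hm]].
  { intros t Ht. set (x := (x2 + t * d)%C).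
    assert (Hx : Cmod (Cexp x) < 1).
    { apply Hneg. replace (Re x) with (t * Re x1 + (1 - t) * Re x2).
      - nra.
      - unfold x, d. destruct x1, x2. simpl. ring. }
    assert (Hn := one_plus_mult_neq_0 B (Cexp x) ltac:(lra) Hx).
    assert (H1 := is_C_derive_log_extremal A B (Cexp x) HB HBA HA Hx).
    assert (H2 := is_C_derive_comp (log_extremal A B) Cexp x _ _ H1 (is_derive_Cexp x)).
    assert (H3 := is_C_derive_plus (fun x => x) _ x _ _ (is_C_derive_id x) H2).
    replace ((1 + A * Cexp x) / (1 + B * Cexp x))%C
      with (1 + (A - B) / (1 + B * Cexp x) * Cexp x)%C by (field; exact Hn).
    exact H3. }
  assert (Hx : Cmod (Cexp (x2 + t * d)%C) < 1).
  { apply Hneg. replace (Re (x2 + t * d)%C) with (t * Re x1 + (1 - t) * Re x2).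
    - nra.
    - unfold d. destruct x1, x2. simpl. ring. }
  assert (HP := Re_janowski_pos A B _ HB HBA HA Hx).
  set (p := ((1 + A * Cexp (x2 + t * d)) / (1 + B * Cexp (x2 + t * d)))%C) in *.
  assert (Hpsi : psi (x2 + d)%C = psi x2).
  { unfold psi. replace (x2 + d)%C with x1 by (unfold d; ring). rewrite Hx1, Hx2. unfold x2. ring. }
  rewrite Hpsi in Hm.
  assert (HD : Re (Cconj d * p * d)%C = Cmod d ^ 2 * Re p).
  { rewrite Cmod2_alt. destruct d, p. simpl. ring. }
  rewrite HD in Hm.
  assert (Hd : Cmod d = 0).
  { assert (G := Cmod_ge_0 d). destruct (Rle_lt_or_eq_dec _ _ G) as [G1|G1]; [|symmetry; exact G1].
    assert (0 < Cmod d ^ 2 * Re p) by (apply Rmult_lt_0_compat; [apply pow_lt|]; assumption). lra. }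
  apply Cmod_eq_0 in Hd. rewrite <- Hx1, <- Hx2. f_equal.
  replace x1 with (x2 + d)%C by (unfold d; ring). rewrite Hd. ring.
Qed.

Lemma extremal_class_S A B : -1 <= B -> B < A -> A <= 1 -> class_S (extremal A B).
Proof.
  intros HB HBA HA. split; [|apply extremal_univalent; assumption].
  apply class_A_id_mult_psum; [apply extremal_disk_coeffs; assumption|reflexivity].
Qed.

Lemma zf'_over_f_extremal A B z : -1 <= B -> B < A -> A <= 1 -> Cmod z < 1 ->
  zf'_over_f (extremal A B) z = ((1 + A * z) / (1 + B * z))%C.
Proof.
  intros HB HBA HA Hz. assert (Hn := one_plus_mult_neq_0 B z ltac:(lra) Hz).
  unfold zf'_over_f. destruct (Ceq_dec z 0) as [->|Hz0].
  - apply C_ext; simpl; field.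
  - assert (HD : C_derive (extremal A B) z
      = (1 * extremal_factor A B z + z * ((A - B) / (1 + B * z) * extremal_factor A B z))%C).
    { apply is_C_derive_unique.
      exact (is_C_derive_mult (fun z => z) _ z _ _ (is_C_derive_id z)
        (is_C_derive_extremal_factor A B z HB HBA HA Hz)). }
    rewrite HD. unfold extremal.
    assert (N : extremal_factor A B z <> RtoC 0).
    { rewrite (extremal_factor_Cexp A B z HB HBA HA Hz). apply Cexp_neq_0. }
    field. repeat split; assumption.
Qed.

Lemma extremal_janowski A B : -1 <= B -> B < A -> A <= 1 -> janowski A B (extremal A B).
Proof.
  intros HB HBA HA. split; [apply extremal_class_S; assumption|].
  exists (fun z => z). split; [|split; [|split]].
  - intros z _. apply ex_C_derive_id.
  - auto.
  - reflexivity.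
  - intros z Hz. apply zf'_over_f_extremal; assumption.
Qed.

(** * Necessity of the two linear conditions *)

Lemma frakB_real_value w (q : R) : Cmod w < 1 -> 0 < q -> frakB w = RtoC q -> frakB_min < q < frakB_max.
Proof.
  intros Hw Hq E.
  assert (F0 := frakB_min_pos). assert (F1 := frakB_min_lt_1). assert (F2 := frakB_max_gt_1).
  assert (F3 := frakB_min_sqr). assert (F4 := frakB_min_max_sqr).
  assert (HT : (1 + Ctanh w = RtoC (q * q))%C).
  { rewrite <- (Csqrt_squared (1 + Ctanh w)%C). unfold frakB in E. rewrite E, RtoC_mult. reflexivity. }
  unfold Ctanh in HT. set (X := Cexp w) in *. set (X' := Cexp (- w)%C) in *.
  assert (HXX : (X * X' = 1)%C) by apply Cexp_opp_r.
  (* Where [X + X'] vanishes, total division makes [Ctanh w] zero, hence [q = 1], which lies in the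
     interval anyway. *)
  destruct (Ceq_dec (X + X')%C 0) as [HS|HS].
  { assert (H0 : (/ (X + X') = 0)%C).
    { rewrite HS. apply C_ext; simpl; unfold Rdiv; ring. }
    unfold Cdiv in HT. rewrite H0, Cmult_0_r, Cplus_0_r in HT. apply RtoC_inj in HT.
    assert (q = 1) by nra. lra. }
  (* The equation says [exp (2 w) = q^2 / (2 - q^2)]. The right side is real, so [sin (2 v) = 0] for
     [v = Im w], and [|2 v| < 2 < PI] leaves only [v = 0]. Then [exp (2 u)] lies strictly between
     [e^(-2)] and [e^2]. *)
  assert (H1 : (X * X * (2 - RtoC (q * q)) = RtoC (q * q))%C).
  { assert (H2 : (RtoC (q * q) * (X + X') = (X + X') + (X - X'))%C).
    { rewrite <- HT. field. exact HS. }
    replace (X * X * (2 - RtoC (q * q)))%C with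
      (2 * (X * X) - X * (RtoC (q * q) * (X + X')) + RtoC (q * q) * (X * X'))%C by ring.
    rewrite H2, HXX. ring. }
  unfold X in H1. rewrite <- Cexp_plus in H1.
  assert (Hre := re_le_Cmod w). assert (Him := im_le_Cmod w).
  destruct w as [u v]. simpl in Hre, Him.
  assert (Hu : -1 < u < 1) by (apply Rabs_le_between in Hre; lra).
  assert (Hv : -1 < v < 1) by (apply Rabs_le_between in Him; lra).
  unfold Cexp in H1. simpl in H1.
  assert (I1 := f_equal Re H1). assert (I2 := f_equal Im H1). simpl in I1, I2. clear H1.
  set (Y := exp (u + u)) in *.
  assert (HY : 0 < Y) by apply exp_pos.
  assert (Hsin : sin (v + v) = 0).
  { assert (I3 : Y * sin (v + v) * (2 - q * q) = 0) by lra.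
    destruct (Req_dec (2 - q * q) 0) as [Hz|Hz].
    - exfalso. assert (q * q = 0); [|nra].
      rewrite <- I1. replace (q * q) with 2 by lra. ring.
    - apply Rmult_integral in I3. destruct I3 as [I3|I3]; [|contradiction].
      apply Rmult_integral in I3. destruct I3 as [I3|I3]; [lra|exact I3]. }
  assert (Hv0 : v = 0).
  { assert (HPI := PI2_1).
    destruct (Rtotal_order v 0) as [H|[H|H]]; [|exact H|]; exfalso.
    - assert (0 < sin (- (v + v))) by (apply sin_gt_0; lra). rewrite sin_neg in *. lra.
    - assert (0 < sin (v + v)) by (apply sin_gt_0; lra). lra. }
  assert (Hcos : cos (v + v) = 1) by (rewrite Hv0, Rplus_0_r; apply cos_0).
  rewrite Hcos, Hsin in I1.
  assert (I4 : Y * (2 - q * q) = q * q) by lra.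
  assert (HYe : Y < euler_e ^ 2).
  { unfold Y, euler_e. replace (exp 1 ^ 2) with (exp (1 + 1)) by (rewrite exp_plus; ring).
    apply exp_increasing. lra. }
  assert (HYe' : 1 < Y * euler_e ^ 2).
  { unfold Y, euler_e. replace (exp 1 ^ 2) with (exp (1 + 1)) by (rewrite exp_plus; ring).
    rewrite <- exp_plus. apply Rle_lt_trans with (exp 0); [rewrite exp_0; lra|]. apply exp_increasing. lra. }
  assert (Hq2 : 0 < 2 - q * q) by nra.
  assert (He := euler_e_gt_2).
  assert (HL : frakB_min ^ 2 < q ^ 2).
  { apply Rmult_lt_reg_r with (1 + euler_e ^ 2); [nra|]. rewrite F3.
    assert (J : euler_e ^ 2 * (q * q) = Y * euler_e ^ 2 * (2 - q * q)) by
      (transitivity (euler_e ^ 2 * (Y * (2 - q * q))); [rewrite I4|]; ring).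
    assert (J2 : 1 * (2 - q * q) < Y * euler_e ^ 2 * (2 - q * q)) by (apply Rmult_lt_compat_r; assumption).
    lra. }
  assert (HU : frakB_min ^ 2 < 2 - q ^ 2).
  { apply Rmult_lt_reg_r with (1 + euler_e ^ 2); [nra|]. rewrite F3.
    assert (J2 : Y * (2 - q * q) < euler_e ^ 2 * (2 - q * q)) by (apply Rmult_lt_compat_r; assumption).
    lra. }
  split; nra.
Qed.

(** Let [x] tend to 1: the open disk supplies strict inequalities short of the endpoint, which
    survive there as weak ones. *)
Lemma affine_le_limit a b : (forall x, 0 < x < 1 -> b * x < a) -> b <= a.
Proof.
  intros H. apply Rnot_lt_le. intros Hab.
  destruct (Rle_lt_dec b 0) as [Hb|Hb].
  - specialize (H (1 / 2) ltac:(lra)). assert (Ha : b / 2 < a) by lra. lra.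
  - assert (Hx : 0 < Rmax (1 / 2) (a / b) < 1).
    { split; [eapply Rlt_le_trans; [|apply Rmax_l]; lra|].
      apply Rmax_lub_lt; [lra|]. apply Rmult_lt_reg_r with b; [exact Hb|].
      unfold Rdiv. rewrite Rmult_assoc, Rinv_l; lra. }
    specialize (H _ Hx). assert (H1 := Rmax_r (1 / 2) (a / b)).
    assert (H2 : b * (a / b) <= b * Rmax (1 / 2) (a / b)) by (apply Rmult_le_compat_l; lra).
    replace (b * (a / b)) with a in H2 by (field; lra). lra.
Qed.

Lemma rescaled_in_janowski_bounds A B r : -1 <= B -> B < A -> A <= 1 -> 0 < r <= 1 ->
  rescaled_in starlike_frakB (janowski A B) r ->
  r * (A - frakB_max * B) <= frakB_max - 1 /\ r * (A - frakB_min * B) <= 1 - frakB_min.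
Proof.
  intros HB HBA HA Hr H.
  destruct (H _ (extremal_janowski A B HB HBA HA) r ltac:(lra)) as [_ [w [_ [Hw [_ Hs]]]]].
  assert (HS := extremal_class_S A B HB HBA HA).
  assert (Key : forall x, -1 < x < 1 -> 0 < 1 + B * (r * x) /\
    frakB_min * (1 + B * (r * x)) < 1 + A * (r * x) < frakB_max * (1 + B * (r * x))).
  { intros x Hx.
    assert (Hx1 : Cmod (RtoC x) < 1) by (rewrite Cmod_R; apply Rabs_def1; lra).
    assert (Hrx : Cmod (r * x)%C < 1) by (assert (G := Cmod_scal_lt r x Hr Hx1); lra).
    specialize (Hs _ Hx1). rewrite zf'_over_f_rescale in Hs by assumption.
    rewrite zf'_over_f_extremal in Hs by assumption.
    assert (Hrx' : -1 < r * x < 1) by (split; nra).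
    assert (P1 : 0 < 1 + B * (r * x)) by (destruct (Rle_lt_dec 0 x); nra).
    assert (P2 : 0 < 1 + A * (r * x)) by (destruct (Rle_lt_dec 0 x); nra).
    assert (Hq : frakB_min < (1 + A * (r * x)) / (1 + B * (r * x)) < frakB_max).
    { apply frakB_real_value with (w (RtoC x)).
      - apply Hw, Hx1.
      - apply Rdiv_lt_0_compat; assumption.
      - rewrite <- Hs. unfold Rdiv. rewrite RtoC_mult, RtoC_inv by lra.
        rewrite !RtoC_plus, !RtoC_mult. reflexivity. }
    split; [exact P1|].
    replace (1 + A * (r * x)) with ((1 + A * (r * x)) / (1 + B * (r * x)) * (1 + B * (r * x))) by (field; lra).
    split; apply Rmult_lt_compat_r; lra. }
  split; apply affine_le_limit; intros x Hx.
  - destruct (Key x ltac:(lra)) as [_ [_ K]]. lra.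
  - destruct (Key (- x) ltac:(lra)) as [_ [K _]]. lra.
Qed.

(** * The radius *)

Definition frakB_center : R := (frakB_min + frakB_max) / 2.

(** The mean of [b0] and [b1] is below their quadratic mean, which is 1. *)
Lemma frakB_center_lt_1 : frakB_center < 1.
Proof.
  assert (H := frakB_min_max_sqr). assert (F0 := frakB_min_pos). assert (F1 := frakB_min_lt_1).
  assert (F2 := frakB_max_gt_1). unfold frakB_center. nra.
Qed.

Lemma sqrt2_e_frakB_max : sqrt 2 * euler_e = sqrt (1 + euler_e ^ 2) * frakB_max.
Proof. unfold frakB_max. destruct sqrt_1_plus_e2 as [H _]. field. lra. Qed.

Lemma sqrt2_frakB_min : sqrt 2 = sqrt (1 + euler_e ^ 2) * frakB_min.
Proof. unfold frakB_min. destruct sqrt_1_plus_e2 as [H _]. field. lra. Qed.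

(** All complex analysis ends here: what remains is to maximize [r] under two linear conditions. *)
Lemma is_radius_janowski A B rho : -1 <= B -> B < A -> A <= 1 -> 0 < A -> 0 < rho <= 1 ->
  rho * (A - frakB_max * B) <= frakB_max - 1 -> rho * (A - frakB_min * B) <= 1 - frakB_min ->
  (forall r, 0 < r <= 1 -> r * (A - frakB_max * B) <= frakB_max - 1 ->
     r * (A - frakB_min * B) <= 1 - frakB_min -> r <= rho) ->
  is_radius starlike_frakB (janowski A B) rho.
Proof.
  intros HB HBA HA HA0 Hrho C1 C2 Hmax.
  assert (F1 := frakB_min_lt_1). assert (F2 := frakB_max_gt_1).
  split; [exact Hrho|split].
  - intros f Hf r Hr. apply (janowski_rescaled_starlike A B r f); auto; try lra.
    (* The conditions pass from [rho] to smaller [r]: a nonpositive slope gives a nonpositive left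
       side, a positive one a left side increasing in [r]. *)
    + destruct (Rle_lt_dec (A - frakB_max * B) 0); nra.
    + destruct (Rle_lt_dec (A - frakB_min * B) 0); nra.
  - intros r Hr H.
    destruct (rescaled_in_janowski_bounds A B r HB HBA HA Hr H) as [H1 H2].
    apply Hmax; assumption.
Qed.

(** After cancelling the common root the quotient is [(b1 - 1) / (A - b1 B)]. The equality clause
    below 1 is what later excludes [R1 < R2] when [R1 > R0]. *)
Lemma rad_R1_spec A B : 0 < rad_R1 A B <= 1 /\
  rad_R1 A B * (A - frakB_max * B) <= frakB_max - 1 /\
  (rad_R1 A B < 1 -> rad_R1 A B * (A - frakB_max * B) = frakB_max - 1) /\
  (forall r, 0 < r <= 1 -> r * (A - frakB_max * B) <= frakB_max - 1 -> r <= rad_R1 A B).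
Proof.
  assert (F2 := frakB_max_gt_1). destruct sqrt_1_plus_e2 as [HS _].
  unfold rad_R1. rewrite sqrt2_e_frakB_max. set (S := sqrt (1 + euler_e ^ 2)) in *.
  set (c := A - frakB_max * B).
  replace (A * S - S * frakB_max * B) with (S * c) by (unfold c; ring).
  replace (S * frakB_max - S) with (S * (frakB_max - 1)) by ring.
  destruct Rlt_dec as [Hc|Hc].
  - assert (Hc0 : 0 < c) by nra.
    replace (S * (frakB_max - 1) / (S * c)) with ((frakB_max - 1) / c) by (field; lra).
    set (x := (frakB_max - 1) / c).
    assert (Hxc : x * c = frakB_max - 1) by (unfold x; field; lra).
    assert (Hx : 0 < x) by (apply Rdiv_lt_0_compat; lra).
    assert (M1 := Rmin_l 1 x). assert (M2 := Rmin_r 1 x).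
    split; [split; [apply Rmin_pos; lra|exact M1]|].
    split; [nra|]. split.
    + intros H. unfold Rmin in *. destruct Rle_dec; lra.
    + intros r Hr Hrc. apply Rmin_glb; [lra|]. apply Rmult_le_reg_r with c; lra.
  - assert (Hc0 : c <= 0) by nra.
    split; [lra|]. split; [lra|]. split; [lra|]. intros; lra.
Qed.

Lemma rad_R2_spec A B : 0 < A - frakB_min * B -> 0 < rad_R2 A B <= 1 /\
  rad_R2 A B * (A - frakB_min * B) <= 1 - frakB_min /\
  (forall r, 0 < r <= 1 -> r * (A - frakB_min * B) <= 1 - frakB_min -> r <= rad_R2 A B).
Proof.
  intros Hc0. assert (F1 := frakB_min_lt_1). destruct sqrt_1_plus_e2 as [HS _].
  unfold rad_R2. rewrite sqrt2_frakB_min. set (S := sqrt (1 + euler_e ^ 2)) in *.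
  set (c := A - frakB_min * B) in *.
  replace ((S - S * frakB_min) / (A * S - S * frakB_min * B)) with ((1 - frakB_min) / c).
  - set (x := (1 - frakB_min) / c).
    assert (Hxc : x * c = 1 - frakB_min) by (unfold x; field; lra).
    assert (Hx : 0 < x) by (apply Rdiv_lt_0_compat; lra).
    assert (M1 := Rmin_l 1 x). assert (M2 := Rmin_r 1 x).
    split; [split; [apply Rmin_pos; lra|exact M1]|].
    split; [nra|]. intros r Hr Hrc. apply Rmin_glb; [lra|]. apply Rmult_le_reg_r with c; lra.
  - replace (A * S - S * frakB_min * B) with (S * c) by (unfold c; ring). field. lra.
Qed.

(* [r] is below [rad_R0] exactly when the disk of diameter
   [(1 - A r) / (1 - B r), (1 + A r) / (1 + B r)] is centered at or above
   [frakB_center]. *)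
Lemma rad_R0_spec A B r : 0 <= B -> B < A -> 0 < r ->
  Rbar_le (Finite r) (rad_R0 A B) <-> frakB_center * (1 - B ^ 2 * r ^ 2) <= 1 - A * B * r ^ 2.
Proof.
  intros HB HBA Hr. assert (FM := frakB_center_lt_1).
  assert (FM0 : 0 < frakB_center).
  { unfold frakB_center. assert (F0 := frakB_min_pos). assert (F2 := frakB_max_gt_1). lra. }
  unfold rad_R0. destruct Req_EM_T as [->|HB0].
  - simpl. split; [intros _; nra|intros _; exact I].
  - destruct sqrt_1_plus_e2 as [HS HS2].
    assert (Hs2 : 0 < sqrt 2) by (apply sqrt_lt_R0; lra).
    set (T := sqrt (2 * (1 + euler_e ^ 2))).
    assert (HT : T = sqrt 2 * sqrt (1 + euler_e ^ 2)).
    { apply sqrt_mult; [lra|]. assert (He := euler_e_gt_2). nra. }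
    assert (HT0 : 0 < T) by (rewrite HT; apply Rmult_lt_0_compat; assumption).
    (* This relation lets [T] cancel, leaving [R0^2 = (1 - c) / (B (A - c B))] with [c] the
       center. *)
    assert (He : euler_e + 1 = frakB_center * T).
    { unfold frakB_center, frakB_min, frakB_max. rewrite HT.
      replace ((sqrt 2 / sqrt (1 + euler_e ^ 2) + sqrt 2 * euler_e / sqrt (1 + euler_e ^ 2)) / 2 *
        (sqrt 2 * sqrt (1 + euler_e ^ 2))) with (sqrt 2 * sqrt 2 / 2 * (1 + euler_e)) by (field; lra).
      rewrite sqrt_sqrt; lra. }
    set (c := frakB_center) in *.
    assert (HBc : 0 < B * (A - c * B)) by (apply Rmult_lt_0_compat; nra).
    replace ((T - euler_e - 1) / (B * (T * A - B * euler_e - B))) with ((1 - c) / (B * (A - c * B))).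
    + set (x := (1 - c) / (B * (A - c * B))).
      assert (Hx : x * (B * (A - c * B)) = 1 - c).
      { unfold x. field. split; [nra|exact HB0]. }
      assert (Hx0 : 0 < x) by (apply Rdiv_lt_0_compat; lra).
      assert (Hsx := pow2_sqrt x ltac:(lra)). assert (Hsx0 := sqrt_pos x).
      simpl Rbar_le. split; intros H.
      * assert (r ^ 2 <= x) by nra. nra.
      * assert (r ^ 2 * (B * (A - c * B)) <= x * (B * (A - c * B))) by lra.
        assert (r ^ 2 <= x) by (apply Rmult_le_reg_r with (B * (A - c * B)); assumption).
        apply Rnot_lt_le. intros Hlt. nra.
    + replace (T - euler_e - 1) with (T * (1 - c)) by lra.
      replace (B * (T * A - B * euler_e - B)) with (T * (B * (A - c * B))).
      * field. repeat split; nra.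
      * replace (B * (T * A - B * euler_e - B)) with (B * (T * A - B * (euler_e + 1))) by ring.
        rewrite He. ring.
Qed.

(** The right end of the image diameter is at most [b1] and its center at least that of [(b0, b1)],
    so its left end, twice the center minus the right end, is at least [b0]. The argument is carried
    out after multiplication by [1 - B^2 r^2]. *)
Lemma lower_bound_of_upper_bound A B r : -1 <= B <= 1 -> 0 < A -> 0 < r <= 1 -> B * r < 1 ->
  r * (A - frakB_max * B) <= frakB_max - 1 ->
  frakB_center * (1 - B ^ 2 * r ^ 2) <= 1 - A * B * r ^ 2 ->
  r * (A - frakB_min * B) <= 1 - frakB_min.
Proof.
  intros HB HA Hr HBr C1 C0. assert (F2 := frakB_max_gt_1).
  assert (P1 : 0 < A * r) by (apply Rmult_lt_0_compat; lra).
  assert (P2 : 0 < 1 + B * r).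
  { apply Rmult_lt_reg_l with frakB_max; [lra|]. lra. }
  unfold frakB_center in C0.
  assert (K : (1 + A * r) * (1 - B * r) <= frakB_max * (1 + B * r) * (1 - B * r)).
  { apply Rmult_le_compat_r; lra. }
  assert (K2 : frakB_min * (1 - B * r) * (1 + B * r) <= (1 - A * r) * (1 + B * r)) by nra.
  apply Rmult_le_reg_r in K2; lra.
Qed.

Theorem theorem4p1 :
  (forall A B : R, -1 <= B -> B < 0 -> 0 < A -> A <= 1 ->
     is_radius starlike_frakB (janowski A B) (rad_R1 A B)) /\
  (forall A B : R, 0 <= B -> B < A -> A <= 1 ->
     (Rbar_le (Finite (rad_R1 A B)) (rad_R0 A B) ->
        is_radius starlike_frakB (janowski A B) (rad_R1 A B)) /\
     (Rbar_lt (rad_R0 A B) (Finite (rad_R1 A B)) ->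
        is_radius starlike_frakB (janowski A B) (rad_R2 A B))).
Proof.
  assert (FM := frakB_center_lt_1). assert (F0 := frakB_min_pos).
  assert (F1 := frakB_min_lt_1). assert (F2 := frakB_max_gt_1).
  split.
  - intros A B HB HB0 HA0 HA.
    destruct (rad_R1_spec A B) as [S1 [S2 [_ S4]]]. set (r := rad_R1 A B) in *.
    apply is_radius_janowski; auto; try lra.
    apply lower_bound_of_upper_bound; auto; try lra; [nra|].
    (* For [B < 0] the center [(1 - A B r^2) / (1 - B^2 r^2)] is at least 1, hence above
       [frakB_center], and the upper condition alone decides. *)
    assert (0 <= - (A * B)) by nra. assert (0 <= r ^ 2 <= 1) by nra.
    assert (0 <= B ^ 2 * r ^ 2 <= 1) by nra.
    assert (0 < frakB_center) by (unfold frakB_center; lra). nra.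
  - intros A B HB HBA HA.
    destruct (rad_R1_spec A B) as [S1 [S2 [S3 S4]]].
    assert (HBr : forall r, 0 < r <= 1 -> B * r < 1) by (intros; nra).
    split; intros H0.
    + apply rad_R0_spec in H0; [|lra|lra|lra].
      apply is_radius_janowski; auto; try lra.
      apply lower_bound_of_upper_bound; auto; lra.
    + assert (Hc : 0 < A - frakB_min * B) by nra.
      destruct (rad_R2_spec A B Hc) as [T1 [T2 T3]].
      assert (H0' : ~ frakB_center * (1 - B ^ 2 * rad_R1 A B ^ 2) <= 1 - A * B * rad_R1 A B ^ 2).
      { rewrite <- rad_R0_spec by lra. apply Rbar_lt_not_le. exact H0. }
      apply Rnot_le_lt in H0'. unfold frakB_center in H0'.
      set (r1 := rad_R1 A B) in *. set (r2 := rad_R2 A B) in *.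
      (* If [r1 < r2], then [r1 < 1] and the right end at [r1] is exactly [b1], while the center is
         too low. So the left end falls below [b0], against the lower condition, which [r1] inherits
         from [r2]. *)
      assert (H21 : r2 <= r1).
      { apply Rnot_lt_le. intros Hlt. specialize (S3 ltac:(lra)).
        assert (C2 : r1 * (A - frakB_min * B) <= 1 - frakB_min) by nra.
        assert (P : 0 < 1 + B * r1) by nra.
        assert (K : (1 - A * r1 - frakB_min * (1 - B * r1)) * (1 + B * r1) < 0) by nra.
        nra. }
      apply is_radius_janowski; auto; try lra.
      destruct (Rle_lt_dec (A - frakB_max * B) 0); nra.
Qed.
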